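(* Let $H$ be a complex Hilbert space and $\{\mathcal{U}(t)\}_{t\geq 0}$ a strongly continuous semigroup on $H$ with generator $\mathcal{L}$. Let $z\in D(\mathcal{L}^\dagger)$ with $z\neq0$, $\mathcal{P}:=(\cdot,z)(z,z)^{-1}z$, $\mathcal{Q}:=1-\mathcal{P}$. For $x\in H$ let $f(x,\cdot):\mathbb{R}_+\to\mathbb{C}$ be the unique continuous solution of $$f(x,t)=(\mathcal{U}(t)\mathcal{Q}x,\mathcal{Q}\mathcal{L}^\dagger z)(z,z)^{-1}-\int_0^tf(x,t-s)\,(\mathcal{U}(s)z,\mathcal{Q}\mathcal{L}^\dagger z)(z,z)^{-1}\,ds,$$ and define $u(x,t):=\mathcal{P}x+\mathcal{U}(t)\mathcal{Q}x-\int_0^tf(x,t-s)\,\mathcal{U}(s)z\,ds$. Then $\{\mathcal{G}(t):=u(\cdot,t)\}_{t\geq0}$ is a strongly continuous semigroup of bounded linear operators on $H$.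
   Context: The scalar product $(\cdot,\cdot)$ on $H$ is conjugate-linear in its second argument. The generator is $\mathcal{L}x:=\lim_{h\searrow 0}\frac1h[\mathcal{U}(h)x-x]$ on the set $D(\mathcal{L})$ where the limit exists; $\dagger$ denotes the adjoint. Integrals are Bochner integrals. *)

(* Defs.v *)
From HB Require Import structures.
From mathcomp Require Import all_boot all_order all_algebra.
From mathcomp Require Import all_classical all_reals all_analysis.
From mathcomp.real_closed Require Import complex.
Import Order.TTheory GRing.Theory Num.Theory.
Import numFieldNormedType.Exports.

Set Implicit Arguments.
Unset Strict Implicit.
Unset Printing Implicit Defensive.

Local Open Scope ring_scope.
Local Open Scope classical_set_scope.

Definition Cplx (R : realType) : normedModType R[i] := (R[i])^o.

Definition ofR (R : realType) (r : R) : R[i] := (r%:C)%C.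

Definition is_inner_product (R : realType) (H : normedModType R[i])
    (ip : H -> H -> R[i]) : Prop :=
  [/\ forall (a : R[i]) (x y w : H), ip (a *: x + y) w = a * ip x w + ip y w,
      forall x y : H, ip y x = (ip x y)^*
    & forall x : H, ip x x = `|x| ^+ 2].

Definition bdd_Clinear (R : realType) (H : normedModType R[i])
    (A : H -> H) : Prop :=
  (forall (a : R[i]) (x y : H), A (a *: x + y) = a *: A x + A y) /\
  exists M : R[i], forall x : H, `|A x| <= M * `|x|.

Definition C0_semigroup (R : realType) (H : normedModType R[i])
    (U : R -> H -> H) : Prop :=
  [/\ forall t : R, 0 <= t -> bdd_Clinear (U t),
      forall x : H, U 0 x = x,
      forall (s t : R) (x : H), 0 <= s -> 0 <= t -> U (s + t) x = U s (U t x)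
    & forall x : H, {within `[0, +oo[, continuous (fun t : R => U t x)}].

Definition diff_quot (R : realType) (H : normedModType R[i])
    (U : R -> H -> H) (x : H) (h : R) : H :=
  ofR h^-1 *: (U h x - x).

Definition sg_gen_dom (R : realType) (H : normedModType R[i])
    (U : R -> H -> H) (x : H) : Prop :=
  exists v : H, diff_quot U x h @[h --> 0^'+] --> v.

Definition sg_gen (R : realType) (H : normedModType R[i])
    (U : R -> H -> H) (x : H) : H :=
  lim (diff_quot U x h @[h --> 0^'+]).

(** [is_gen_adjoint ip U z w] : z \in D(L^dagger) and L^dagger z = w, i.e.
    (L x, z) = (x, w) for all x \in D(L). (D(L) is dense for a C0-semigroup,
    so w is uniquely determined by z.) *)
Definition is_gen_adjoint (R : realType) (H : normedModType R[i])
    (ip : H -> H -> R[i]) (U : R -> H -> H) (z w : H) : Prop :=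
  forall x : H, sg_gen_dom U x -> ip (sg_gen U x) z = ip x w.

(** Integral over [0,t] of a continuous function g with values in a complex
    normed space, as the limit of the Riemann sums
    (t/n) sum_{k<n} g(k t / n).  For continuous integrands (the only ones
    used below) this coincides with the Bochner integral. *)
Definition bochner0t (R : realType) (V : normedModType R[i])
    (g : R -> V) (t : R) : V :=
  lim ((ofR (t / n%:R) *: \sum_(k < n) g (k%:R * t / n%:R)) @[n --> \oo]).

Definition projP (R : realType) (H : normedModType R[i])
    (ip : H -> H -> R[i]) (z x : H) : H :=
  (ip x z / ip z z) *: z.

Definition projQ (R : realType) (H : normedModType R[i])
    (ip : H -> H -> R[i]) (z x : H) : H :=
  x - projP ip z x.

(* Main.v *)
(** Let [w = Q L^dagger z / (z, z)].  As [w] is orthogonal to [z], the equation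
    for [f] says [f(x, t) = (Y(t), w)], where
    [Y(t) = U(t) Q x - int_0^t f(x, t - s) U(s) z ds].  Splitting the integral
    gives [Y(h + t) = U(h) Y(t) - int_0^h f(x, t + h - s) U(s) z ds].  Together
    with [(U(h) y - y, z) = (int_0^h U(s) y ds, L^dagger z)], which holds for all
    [y] because the integral lies in [D(L)], this shows that [p = (Y, z)] has
    right derivative [kappa p] with [p(0) = 0], so [p = 0].  Hence
    [P u(x, t) = P x] and [Q u(x, t) = Y(t)], and [f(x, t + .)] solves the same
    Volterra equation as [f(u(x, t), .)]; uniqueness for that equation yields the
    semigroup law and linearity.  Boundedness follows from the a priori bound for
    the Volterra equation and the uniform boundedness principle, which bounds
    [U] on compact time intervals. *)
Require Import Defs.
From mathcomp Require Import all_boot all_order all_algebra.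
From mathcomp Require Import all_classical all_reals all_analysis.
From mathcomp.real_closed Require Import complex.
From mathcomp Require Import ring lra.
Import Order.TTheory GRing.Theory Num.Theory.
Import numFieldNormedType.Exports.
Set Implicit Arguments.
Unset Strict Implicit.
Unset Printing Implicit Defensive.
Local Open Scope ring_scope.
Local Open Scope classical_set_scope.

(* The norm of a module over [R[i]] takes its values in [R[i]]; [rnorm] is the
   same norm with values in [R]. *)
Definition rnorm (R : realType) (V : normedZmodType R[i]) (x : V) : R :=
  complex.Re `|x|.

(** * Real-valued norms; uniform continuity and boundedness on segments *)

Section RealNorm.
Context {R : realType}.

Lemma ofR_ge0 (r : R) : (0 <= ofR r) = (0 <= r).
Proof. exact: ler0c. Qed.

Lemma ofR_gt0 (r : R) : (0 < ofR r) = (0 < r).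
Proof. exact: (ltcR 0 r). Qed.

Lemma gt0_ofR (e : R[i]) : 0 < e -> exists2 r : R, 0 < r & e = ofR r.
Proof.
move=> e0; have /complex_realP[r er] := gtr0_real e0.
by exists r => //; rewrite -ofR_gt0 /ofR -er.
Qed.

Lemma ofRD (r s : R) : ofR (r + s) = ofR r + ofR s.
Proof. by rewrite /ofR rmorphD. Qed.
Lemma ofRB (r s : R) : ofR (r - s) = ofR r - ofR s.
Proof. by rewrite /ofR rmorphB. Qed.
Lemma ofRM (r s : R) : ofR (r * s) = ofR r * ofR s.
Proof. by rewrite /ofR rmorphM. Qed.
Lemma ofRn (n : nat) : ofR (n%:R : R) = n%:R.
Proof. by rewrite /ofR rmorph_nat. Qed.
Lemma ofR1 : ofR (1 : R) = 1.
Proof. by rewrite /ofR rmorph1. Qed.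
Lemma ofR0 : ofR (0 : R) = 0.
Proof. by rewrite /ofR rmorph0. Qed.

Section Zmod.
Context {V : normedZmodType R[i]}.
Implicit Types x y : V.

Lemma normE x : `|x| = ofR (rnorm x).
Proof. by rewrite /rnorm /ofR RRe_real // normr_real. Qed.

Lemma rnorm_ge0 x : 0 <= rnorm x.
Proof. by rewrite -ofR_ge0 -normE. Qed.

Lemma rnorm0 : rnorm (0 : V) = 0.
Proof. by rewrite /rnorm normr0. Qed.

Lemma rnorm_eq0 x : rnorm x = 0 -> x = 0.
Proof. by move=> x0; apply/normr0_eq0; rewrite normE x0 ofR0. Qed.

Lemma rnormN x : rnorm (- x) = rnorm x.
Proof. by rewrite /rnorm normrN. Qed.

Lemma rnormB x y : rnorm (x - y) = rnorm (y - x).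
Proof. by rewrite -rnormN opprB. Qed.

Lemma rnormD x y : rnorm (x + y) <= rnorm x + rnorm y.
Proof. by have := ler_normD x y; rewrite !normE -ofRD lecR. Qed.

Lemma rnorm_sum (I : Type) (r : seq I) (P : pred I) (F : I -> V) :
  rnorm (\sum_(i <- r | P i) F i) <= \sum_(i <- r | P i) rnorm (F i).
Proof.
elim/big_ind2 : _ => [|a b c d ab cd|//]; first by rewrite rnorm0.
exact: le_trans (rnormD _ _) (lerD ab cd).
Qed.

End Zmod.

Lemma rnormM (a b : R[i]) : rnorm (a * b) = rnorm a * rnorm b.
Proof. by apply: complexI; rewrite -!/(ofR _) ofRM -!normE normrM. Qed.

Lemma rnorm_ofR (r : R) : rnorm (ofR r) = `|r|.
Proof. by rewrite /rnorm normc_def /= expr0n addr0 sqrtr_sqr. Qed.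

Lemma rnormZ (V : normedModType R[i]) (a : R[i]) (x : V) :
  rnorm (a *: x) = rnorm a * rnorm x.
Proof. by apply: complexI; rewrite -!/(ofR _) ofRM -!normE normrZ. Qed.

(** An element of [R[i]] that is positive for the partial order is real, so real radii suffice to
    test convergence. *)
Lemma cvg_rnormP {V : normedModType R[i]} {T : Type} {F : set_system T}
    {FF : Filter F} (f : T -> V) (l : V) :
  f x @[x --> F] --> l <->
  forall e : R, 0 < e -> \forall x \near F, rnorm (f x - l) < e.
Proof.
rewrite cvgrPdist_lt; split=> h e e0.
  have := h (ofR e); rewrite ofR_gt0 => /(_ e0).
  by apply: filterS => x; rewrite normE ltcR rnormB.
have [r r0 ->] := gt0_ofR e0.
by move: (h r r0); apply: filterS => x; rewrite normE ltcR rnormB.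
Qed.

Lemma continuous_rnorm {V : normedModType R[i]} : continuous (@rnorm R V).
Proof.
move=> x; apply/cvgrPdist_lt => e e0.
have /cvg_rnormP/(_ e e0) : (y : V) @[y --> x] --> x by exact: cvg_id.
apply: filterS => y; apply: le_lt_trans.
rewrite ler_norml; apply/andP; split.
  by have := rnormD (y - x) x; rewrite subrK; lra.
by have := rnormD (x - y) y; rewrite subrK rnormB; lra.
Qed.

Lemma rnorm_small {V : normedModType R[i]} (x : V) :
  (forall e : R, 0 < e -> rnorm x <= e) -> x = 0.
Proof.
move=> h; apply: rnorm_eq0; apply/eqP; rewrite eq_le rnorm_ge0 andbT.
by apply/ler_addgt0Pl => e e0; rewrite addr0; exact: h.
Qed.

Lemma cvg_rnorm_le {V : normedModType R[i]} {T : Type} {F : set_system T}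
    {FF : ProperFilter F} (f : T -> V) (l : V) (M : R) :
  f x @[x --> F] --> l -> (\forall x \near F, rnorm (f x) <= M) -> rnorm l <= M.
Proof.
move=> fl fM; have h : rnorm (f x) @[x --> F] --> rnorm l.
  by apply: (cvg_comp _ _ fl); exact: continuous_rnorm.
exact: (cvgr_to_le h fM).
Qed.

(** Heine's theorem from the near-covering form of compactness, the modulus being the parameter that
    runs through [0^'+]. Near [x], half the modulus found at [x] serves every centre [y]. *)
Lemma unif_cont_segment {V : normedModType R[i]} (g : R -> V) (a b e : R) :
  continuous g -> 0 < e ->
  exists2 d, 0 < d & forall s t, a <= s <= b -> a <= t <= b ->
    `|s - t| < d -> rnorm (g s - g t) < e.
Proof.
move=> cg e0.
have /compact_near_coveringP/(_ _ (0 : R)^'+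
  (fun d x => forall s, `|s - x| < d -> rnorm (g s - g x) < e)) :
  compact `[a, b] by exact: segment_compact.
case=> [x _|d /= d0 Hd].
  have /cvg_rnormP/(_ (e / 2)) := cg x.
  rewrite divr_gt0 // => /(_ isT) [d /= d0 Hd].
  exists (ball x (d / 2), [set r | 0 < r < d / 2]).
    split; first by apply: nbhsx_ballx; rewrite divr_gt0.
    near=> r; apply/andP; split; near: r; first exact: nbhs_right_gt.
    by apply: nbhs_right_lt; rewrite divr_gt0.
  move=> [y r] /= [yx /andP[r0 rd]] s sy.
  rewrite /ball /= in yx.
  have sx : `|x - s| < d.
    have -> : x - s = (x - y) - (s - y) by ring.
    by apply: le_lt_trans (ler_normB _ _) _; lra.
  have yx' : `|x - y| < d by lra.
  have -> : g s - g y = (g s - g x) - (g y - g x).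
    by rewrite opprB addrA subrK.
  apply: le_lt_trans (rnormD _ _) _; rewrite rnormN.
  by have := Hd _ sx; have := Hd _ yx'; lra.
exists (d / 2); first by rewrite divr_gt0.
move=> s t sab tab st.
apply: (Hd (d / 2)) => //=; rewrite ?in_itv //= ?divr_gt0 //.
by rewrite sub0r normrN gtr0_norm; lra.
Unshelve. all: by end_near. Qed.

Lemma bounded_segment {V : normedModType R[i]} (g : R -> V) (a b : R) :
  continuous g ->
  exists2 M, 0 <= M & forall s, a <= s <= b -> rnorm (g s) <= M.
Proof.
move=> cg; have [ab|ba] := leP a b; last first.
  by exists 0 => // s /andP[s1 s2]; have := le_trans s1 s2; rewrite leNgt ba.
have [|c _ Hc] := @EVT_max _ (fun s => rnorm (g s)) a b ab.
  apply: continuous_subspaceT => x.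
  exact: (cvg_comp _ _ (cg x) (@continuous_rnorm V (g x))).
exists (rnorm (g c)); first exact: rnorm_ge0.
by move=> s sab; apply: Hc; rewrite in_itv.
Qed.

End RealNorm.

(** * Riemann sums with equally spaced left endpoints *)

Section RiemannSums.
Context {R : realType}.

Definition riemann_sum (V : normedModType R[i]) (g : R -> V) (t : R) (n : nat) : V :=
  ofR (t / n%:R) *: \sum_(k < n) g (k%:R * t / n%:R).

Lemma sample_in (t : R) (n k : nat) :
  0 <= t -> (k < n)%N -> 0 <= k%:R * t / n%:R <= t.
Proof.
move=> t0 kn; have n0 : 0 < n%:R :> R by rewrite ltr0n (leq_ltn_trans _ kn).
rewrite divr_ge0 ?mulr_ge0 ?ler0n //= ler_pdivrMr // mulrC.
by rewrite ler_wpM2l // ler_nat ltnW.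
Qed.

Lemma sum_mul (V : nmodType) (F : nat -> V) (n m : nat) :
  \sum_(j < n * m) F j = \sum_(k < n) \sum_(i < m) F (k * m + i)%N.
Proof.
rewrite -(big_mkord xpredT F).
elim: n => [|n IH]; first by rewrite big_ord0 mul0n big_geq.
rewrite mulSnr (@big_cat_nat _ _ _ (n * m)) ?leq_addr //= IH.
rewrite big_ord_recr /=; congr (_ + _).
rewrite -{1}[(n * m)%N]add0n big_addn addKn big_mkord.
by apply: eq_bigr => i _; rewrite addnC.
Qed.

Section NormedModule.
Context {V : normedModType R[i]}.
Implicit Types (g : R -> V) (t s e d M : R).

Lemma eq_riemann_sum g1 g2 t n : 0 <= t ->
  (forall s, 0 <= s <= t -> g1 s = g2 s) ->
  riemann_sum g1 t n = riemann_sum g2 t n.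
Proof.
move=> t0 h; congr (_ *: _); apply: eq_bigr => k _.
by apply: h; exact: sample_in.
Qed.

Lemma rnorm_riemann_sum_le g t n (F : nat -> R) : 0 <= t ->
  (forall k, (k < n)%N -> rnorm (g (k%:R * t / n%:R)) <= F k) ->
  rnorm (riemann_sum g t n) <= t / n%:R * \sum_(k < n) F k.
Proof.
move=> t0 h; have tn : 0 <= t / n%:R by rewrite divr_ge0.
rewrite rnormZ rnorm_ofR ger0_norm // ler_wpM2l //.
by apply: le_trans (rnorm_sum _ _ _) _; apply: ler_sum => k _; exact: h.
Qed.

Lemma rnorm_riemann_sum g t n M : 0 <= t -> 0 <= M ->
  (forall s, 0 <= s <= t -> rnorm (g s) <= M) ->
  rnorm (riemann_sum g t n) <= t * M.
Proof.
move=> t0 M0 h.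
have /(_ (fun=> M)) := @rnorm_riemann_sum_le g t n _ t0.
move=> /(_ _)/le_trans; apply; first by move=> k kn; apply/h/sample_in.
rewrite sumr_const card_ord -[M *+ _]mulr_natr.
case: n => [|n]; first by rewrite mulr0n !mulr0 mulr_ge0.
by rewrite mulrACA mulVf ?mulr1 // pnatr_eq0.
Qed.

Lemma riemann_sumD g1 g2 t n :
  riemann_sum (fun s => g1 s + g2 s) t n =
  riemann_sum g1 t n + riemann_sum g2 t n.
Proof. by rewrite /riemann_sum -scalerDr -big_split. Qed.

Lemma riemann_sumZ (a : R[i]) g t n :
  riemann_sum (fun s => a *: g s) t n = a *: riemann_sum g t n.
Proof. by rewrite /riemann_sum -scaler_sumr !scalerA mulrC. Qed.

Lemma riemann_sumB g1 g2 t n :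
  riemann_sum (fun s => g1 s - g2 s) t n =
  riemann_sum g1 t n - riemann_sum g2 t n.
Proof. by rewrite /riemann_sum -scalerBr -sumrB. Qed.

Lemma riemann_sum_cst (v : V) t n : (0 < n)%N ->
  riemann_sum (fun=> v) t n = ofR t *: v.
Proof.
move=> n0; rewrite /riemann_sum sumr_const card_ord -[v *+ _]scaler_nat scalerA.
by rewrite -ofRn -ofRM divfK // pnatr_eq0 -lt0n.
Qed.

(** Rescaling to [0, 1] lets sums over intervals of different lengths share their sample points. *)
Lemma riemann_sum_scaled g t n :
  riemann_sum g t n = ofR t *: riemann_sum (fun s => g (s * t)) 1 n.
Proof.
rewrite /riemann_sum scalerA -ofRM mul1r; congr (_ *: _).
by apply: eq_bigr => k _; rewrite mulr1 mulrAC.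
Qed.

(** Repeating each coarse sample [m] times puts both sums on the same mesh. Corresponding sample
    points differ by less than [t / n], hence by less than [d], and the weights add up to [t]. *)
Lemma riemann_sum_refine g t e d n m :
  0 <= t -> 0 <= e ->
  (forall s u, 0 <= s <= t -> 0 <= u <= t -> `|s - u| < d ->
     rnorm (g s - g u) <= e) ->
  (0 < n)%N -> (0 < m)%N -> t / n%:R < d ->
  rnorm (riemann_sum g t (n * m) - riemann_sum g t n) <= t * e.
Proof.
move=> t0 e0 h n0 m0 tn.
have nn0 : 0 < n%:R :> R by rewrite ltr0n.
have mm0 : 0 < m%:R :> R by rewrite ltr0n.
have -> : riemann_sum g t n =
    ofR (t / (n * m)%:R) *: \sum_(k < n) \sum_(i < m) g (k%:R * t / n%:R).
  under [in RHS]eq_bigr do rewrite sumr_const card_ord -[_ *+ m]scaler_nat.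
  rewrite -scaler_sumr scalerA -ofRn -ofRM natrM; congr (ofR _ *: _).
  by field; rewrite !gt_eqF.
rewrite /riemann_sum (sum_mul (fun j => g (j%:R * t / (n * m)%:R))) -scalerBr.
rewrite -sumrB; under eq_bigr do rewrite -sumrB.
have tnm : 0 <= t / (n * m)%:R by rewrite divr_ge0.
rewrite rnormZ rnorm_ofR ger0_norm //.
apply: (@le_trans _ _ (t / (n * m)%:R * \sum_(k < n) \sum_(i < m) e)).
  rewrite ler_wpM2l //; apply: le_trans (rnorm_sum _ _ _) _; apply: ler_sum => k _.
  apply: le_trans (rnorm_sum _ _ _) _; apply: ler_sum => i _.
  have kmi : (k * m + i < n * m)%N.
    apply: (@leq_trans (k.+1 * m)); last by rewrite leq_mul2r ltn_ord orbT.
    by rewrite mulSnr ltn_add2l.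
  apply: h; [exact: sample_in|exact: sample_in|].
  have -> : (k * m + i)%:R * t / (n * m)%:R - k%:R * t / n%:R
      = i%:R * (t / n%:R) / m%:R.
    by rewrite natrD !natrM; field; rewrite !gt_eqF.
  have := @sample_in (t / n%:R) m i _ (ltn_ord i); rewrite divr_ge0 //.
  by move=> /(_ isT)/andP[a0 a1]; rewrite ger0_norm // (le_lt_trans a1).
rewrite !sumr_const !card_ord -mulrnA -[e *+ _]mulr_natr mulnC.
by rewrite mulrACA mulVf ?mulr1 // pnatr_eq0 -lt0n muln_gt0 n0 m0.
Qed.

(** Commensurable lengths allow the common mesh [h / n], for which concatenation is exact and not
    only asymptotic. *)
Lemma riemann_sum_cat g t s h (p q n : nat) : (0 < p)%N -> (0 < q)%N ->
  t = p%:R * h -> s = q%:R * h ->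
  riemann_sum g (t + s) ((p + q) * n) =
  riemann_sum g t (p * n) + riemann_sum (fun u => g (t + u)) s (q * n).
Proof.
move=> p0 q0 -> ->; case: (posnP n) => [->|n0].
  by rewrite !muln0 /riemann_sum !big_ord0 !scaler0 addr0.
have pp0 : p%:R != 0 :> R by rewrite pnatr_eq0 -lt0n.
have qq0 : q%:R != 0 :> R by rewrite pnatr_eq0 -lt0n.
have nn0 : n%:R != 0 :> R by rewrite pnatr_eq0 -lt0n.
have pq0 : p%:R + q%:R != 0 :> R by rewrite -natrD pnatr_eq0 -lt0n addn_gt0 p0.
have E1 : (p%:R * h + q%:R * h) / ((p + q) * n)%:R = h / n%:R.
  by rewrite natrM natrD; field; rewrite ?pq0 ?nn0.
have E2 : p%:R * h / (p * n)%:R = h / n%:R.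
  by rewrite natrM; field; rewrite ?pp0 ?nn0.
have E3 : q%:R * h / (q * n)%:R = h / n%:R.
  by rewrite natrM; field; rewrite ?qq0 ?nn0.
rewrite /riemann_sum E1 E2 E3 -scalerDr; congr (_ *: _).
rewrite mulnDl big_split_ord /=; congr (_ + _).
  apply: eq_bigr => k _; congr g; rewrite natrD !natrM.
  by field; rewrite ?pq0 ?pp0 ?nn0 -?mulrDl ?mulf_neq0.
apply: eq_bigr => k _; congr g; rewrite !natrD !natrM.
by field; rewrite ?pq0 ?qq0 ?nn0 -?mulrDl ?mulf_neq0.
Qed.

Lemma riemann_sum0 g n : riemann_sum g 0 n = 0.
Proof. by rewrite /riemann_sum mul0r ofR0 scale0r. Qed.

End NormedModule.

Lemma riemann_sum_map (V W : normedModType R[i]) (A : V -> W) (g : R -> V) t n :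
  (forall a x y, A (a *: x + y) = a *: A x + A y) ->
  A (riemann_sum g t n) = riemann_sum (fun s => A (g s)) t n.
Proof.
move=> lA.
have A0 : A 0 = 0.
  have := lA 1 0 0; rewrite !scale1r addr0 => /(congr1 (fun v => v - A 0)).
  by rewrite addrK subrr.
have AD x y : A (x + y) = A x + A y by have := lA 1 x y; rewrite !scale1r.
have AZ a x : A (a *: x) = a *: A x by have := lA a x 0; rewrite A0 !addr0.
by rewrite /riemann_sum AZ (big_morph A AD A0).
Qed.

End RiemannSums.

(** * The integral of a continuous function as a limit of Riemann sums *)

Section Integral.
Context {R : realType}.

Lemma inv_nat_small (t d : R) : 0 <= t -> 0 < d ->
  exists N : nat, forall n, (N < n)%N -> t / n%:R < d.
Proof.
move=> t0 d0; exists (Num.trunc (t / d)) => n Nn.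
have n0 : 0 < n%:R :> R by rewrite ltr0n (leq_ltn_trans _ Nn).
rewrite ltr_pdivrMr // mulrC -ltr_pdivrMr //.
have /andP[_ /lt_le_trans] := @truncn_itv _ (t / d) (divr_ge0 t0 (ltW d0)).
by apply; rewrite ler_nat.
Qed.

Lemma bochner0tE (V : normedModType R[i]) (g : R -> V) (t : R) (l : V) :
  riemann_sum g t n @[n --> \oo] --> l -> bochner0t g t = l.
Proof. by move=> h; apply: (@cvg_lim V (@norm_hausdorff _ V)). Qed.

Lemma eq_bochner0t (V : normedModType R[i]) (g1 g2 : R -> V) t : 0 <= t ->
  (forall s, 0 <= s <= t -> g1 s = g2 s) -> bochner0t g1 t = bochner0t g2 t.
Proof.
move=> t0 h; rewrite /bochner0t.
by under eq_fun do rewrite -/(riemann_sum _ _ _) (eq_riemann_sum _ t0 h).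
Qed.

Context {H : completeNormedModType R[i]}.
Implicit Types (g : R -> H) (t s e M : R).

(** The sums with [N.+1] and with [n] points are both close to the one with [N.+1 * n] points, their
    common refinement. The sequence is therefore Cauchy, and [H] is complete. *)
Lemma riemann_sum_cvg g t : continuous g -> 0 <= t ->
  riemann_sum g t n @[n --> \oo] --> bochner0t g t.
Proof.
move=> cg t0; suff : cvg (riemann_sum g t n @[n --> \oo]) by [].
apply/cauchy_cvgP/cauchy_exP => e /gt0_ofR[r r0 ->{e}].
(* Two comparisons cost [2 * t * e], which this choice keeps below [r], also when [t = 0]. *)
pose e : R := r / (2 * t + 1) / 2.
have t10 : 0 < 2 * t + 1 by lra.
have e0 : 0 < e by rewrite !divr_gt0.
have [d d0 Hd] := @unif_cont_segment _ _ g 0 t e cg e0.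
have [N HN] := inv_nat_small t0 d0.
have Hd' s u : 0 <= s <= t -> 0 <= u <= t -> `|s - u| < d -> rnorm (g s - g u) <= e.
  by move=> *; apply/ltW/Hd.
exists (riemann_sum g t N.+1).
suff : \forall n \near \oo, ball (riemann_sum g t N.+1) (ofR r) (riemann_sum g t n) by [].
near=> n.
have Nn : (N < n)%N by near: n; exact: nbhs_infty_ge.
rewrite -ball_normE /ball_ /= normE ltcR.
have n0 : (0 < n)%N by exact: leq_ltn_trans Nn.
have h1 := riemann_sum_refine t0 (ltW e0) Hd' n0 (ltn0Sn N) (HN _ Nn).
have h2 := riemann_sum_refine t0 (ltW e0) Hd' (ltn0Sn N) n0 (HN _ (ltnSn N)).
move: h1; rewrite mulnC => h1.
have -> : riemann_sum g t N.+1 - riemann_sum g t n =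
  (riemann_sum g t (N.+1 * n) - riemann_sum g t n) -
  (riemann_sum g t (N.+1 * n) - riemann_sum g t N.+1).
  by rewrite opprB [RHS]addrC addrA subrK.
apply: le_lt_trans (rnormD _ _) _; rewrite rnormN.
apply: (@le_lt_trans _ _ ((2 * t) * e)); first by lra.
rewrite /e mulrA ltr_pdivrMr // mulrA ltr_pdivrMr //.
by nra.
Unshelve. all: by end_near. Qed.

Lemma rnorm_bochner0t_le g t M : continuous g -> 0 <= t -> 0 <= M ->
  (forall s, 0 <= s <= t -> rnorm (g s) <= M) -> rnorm (bochner0t g t) <= t * M.
Proof.
move=> cg t0 M0 h; apply: cvg_rnorm_le (riemann_sum_cvg cg t0) _.
by near=> n; exact: rnorm_riemann_sum.
Unshelve. all: by end_near. Qed.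

Lemma bochner0t_0 g : bochner0t g 0 = 0.
Proof.
apply: bochner0tE; under eq_fun do rewrite riemann_sum0; exact: cvg_cst.
Qed.

Lemma bochner0tD g1 g2 t : continuous g1 -> continuous g2 -> 0 <= t ->
  bochner0t (fun s => g1 s + g2 s) t = bochner0t g1 t + bochner0t g2 t.
Proof.
move=> c1 c2 t0; apply: bochner0tE; under eq_fun do rewrite riemann_sumD.
by apply: cvgD; exact: riemann_sum_cvg.
Qed.

Lemma bochner0tB g1 g2 t : continuous g1 -> continuous g2 -> 0 <= t ->
  bochner0t (fun s => g1 s - g2 s) t = bochner0t g1 t - bochner0t g2 t.
Proof.
move=> c1 c2 t0; apply: bochner0tE; under eq_fun do rewrite riemann_sumB.
by apply: cvgB; exact: riemann_sum_cvg.
Qed.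

Lemma bochner0tZ (a : R[i]) g t : continuous g -> 0 <= t ->
  bochner0t (fun s => a *: g s) t = a *: bochner0t g t.
Proof.
move=> c1 t0; apply: bochner0tE; under eq_fun do rewrite riemann_sumZ.
by apply: cvgZr; exact: riemann_sum_cvg.
Qed.

Lemma bochner0t_cst (v : H) t : bochner0t (fun=> v) t = ofR t *: v.
Proof.
apply: bochner0tE; apply/cvg_rnormP => e e0; near=> n.
rewrite riemann_sum_cst ?subrr ?rnorm0 //.
by near: n; exact: nbhs_infty_ge.
Unshelve. all: by end_near. Qed.

Lemma bochner0t_map (W : normedModType R[i]) (A : H -> W) M g t :
  (forall a x y, A (a *: x + y) = a *: A x + A y) ->
  (forall x, rnorm (A x) <= M * rnorm x) ->
  continuous g -> 0 <= t ->
  bochner0t (fun s => A (g s)) t = A (bochner0t g t).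
Proof.
move=> lA bA cg t0; apply: bochner0tE.
under eq_fun do rewrite -riemann_sum_map //.
have AB x y : A x - A y = A (x - y).
  by rewrite -scaleN1r addrC -lA scaleN1r addrC.
apply/cvg_rnormP => e e0.
have M1 : 0 < `|M| + 1 by rewrite ltr_wpDl.
have /cvg_rnormP/(_ _ (divr_gt0 e0 M1)) := riemann_sum_cvg cg t0.
apply: filterS => n; rewrite ltr_pdivlMr // => h.
rewrite AB; apply: le_lt_trans (bA _) (le_lt_trans _ h).
rewrite mulrC ler_wpM2l ?rnorm_ge0 //.
by have := ler_norm M; lra.
Qed.

(** Once both integrals are rescaled to [0, 1], t1 S1 - t2 S2 = t1 (S1 - S2) + (t1 - t2) S2. This is
    why [e] compares values at the proportional points [c * t1] and [c * t2]. *)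
Lemma rnorm_bochner0tB_le g1 g2 t1 t2 M e :
  continuous g1 -> continuous g2 -> 0 <= t1 -> 0 <= t2 -> 0 <= M -> 0 <= e ->
  (forall c, 0 <= c <= 1 -> rnorm (g1 (c * t1) - g2 (c * t2)) <= e) ->
  (forall s, 0 <= s <= t2 -> rnorm (g2 s) <= M) ->
  rnorm (bochner0t g1 t1 - bochner0t g2 t2) <= t1 * e + `|t1 - t2| * M.
Proof.
move=> c1 c2 t10 t20 M0 e0 h hM.
have L : riemann_sum g1 t1 n - riemann_sum g2 t2 n @[n --> \oo] -->
    bochner0t g1 t1 - bochner0t g2 t2.
  exact: cvgB (riemann_sum_cvg c1 t10) (riemann_sum_cvg c2 t20).
apply: cvg_rnorm_le L _.
near=> n; rewrite (riemann_sum_scaled g1 t1) (riemann_sum_scaled g2 t2).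
set g1' := fun s => g1 (s * t1); set g2' := fun s => g2 (s * t2).
have -> : ofR t1 *: riemann_sum g1' 1 n - ofR t2 *: riemann_sum g2' 1 n =
  ofR t1 *: (riemann_sum g1' 1 n - riemann_sum g2' 1 n) +
  ofR (t1 - t2) *: riemann_sum g2' 1 n.
  by rewrite scalerBr ofRB scalerBl addrA subrK.
apply: le_trans (rnormD _ _) _; apply: lerD.
  rewrite rnormZ rnorm_ofR ger0_norm // ler_wpM2l // -riemann_sumB.
  by rewrite -[leRHS]mul1r; apply: rnorm_riemann_sum.
rewrite rnormZ rnorm_ofR ler_wpM2l // -[leRHS]mul1r.
apply: rnorm_riemann_sum => // s /andP[s0 s1]; apply: hM.
by rewrite mulr_ge0 //= ler_piMl.
Unshelve. all: by end_near. Qed.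

Lemma continuous_comp_addl (T : topologicalType) (g : R -> T) (a : R) :
  continuous g -> continuous (fun s => g (a + s)).
Proof.
move=> cg x; apply: (@cvg_comp _ _ _ (fun s => a + s) g _ (nbhs (a + x))).
  by apply: cvgD; [exact: cvg_cst|exact: cvg_id].
exact: cg.
Qed.

(** Along the subsequences [(p + q) * n], [p * n] and [q * n] the sums concatenate exactly, and the
    limits are unchanged. *)
Lemma bochner0t_cat_commensurable g (h : R) (p q : nat) : continuous g -> 0 <= h ->
  bochner0t g (p%:R * h + q%:R * h) =
  bochner0t g (p%:R * h) + bochner0t (fun u => g (p%:R * h + u)) (q%:R * h).
Proof.
move=> cg h0.
have ph : 0 <= p%:R * h by rewrite mulr_ge0.
have qh : 0 <= q%:R * h by rewrite mulr_ge0.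
case: (posnP p) => [->|p0].
  rewrite mul0r add0r bochner0t_0 add0r; apply: eq_bochner0t => // s _.
  by rewrite add0r.
case: (posnP q) => [->|q0]; first by rewrite mul0r addr0 bochner0t_0 addr0.
have c2 := continuous_comp_addl (a := p%:R * h) cg.
have l1 := riemann_sum_cvg cg (addr_ge0 ph qh).
have l2 := riemann_sum_cvg cg ph.
have l3 := riemann_sum_cvg c2 qh.
have pq0 : (0 < p + q)%N by rewrite addn_gt0 p0.
have m1 : riemann_sum g (p%:R * h + q%:R * h) ((p + q) * n) @[n --> \oo] -->
    bochner0t g (p%:R * h + q%:R * h) := cvg_comp _ _ (cvg_mulnl _ pq0) l1.
have m2 : riemann_sum g (p%:R * h) (p * n) @[n --> \oo] -->
    bochner0t g (p%:R * h) := cvg_comp _ _ (cvg_mulnl _ p0) l2.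
have m3 : riemann_sum (fun u => g (p%:R * h + u)) (q%:R * h) (q * n) @[n --> \oo] -->
    bochner0t (fun u => g (p%:R * h + u)) (q%:R * h) :=
  cvg_comp _ _ (cvg_mulnl _ q0) l3.
rewrite -(cvg_lim (@norm_hausdorff _ H) m1) -(cvg_lim (@norm_hausdorff _ H) (cvgD m2 m3)).
by under eq_fun do rewrite (@riemann_sum_cat _ _ _ _ _ h) //.
Qed.

Lemma bochner0t_left_continuous g t e : continuous g -> 0 <= t -> 0 < e ->
  exists2 d, 0 < d & forall u, 0 <= u <= t -> t - u < d ->
    rnorm (bochner0t g t - bochner0t g u) < e.
Proof.
move=> cg t0 e0.
have [M M0 HM] := @bounded_segment _ _ g 0 t cg.
(* With this modulus the change of integrand costs at most [e / 4]; the second bound on [t - u]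
   makes the change of length cost at most [e / 2]. *)
have e'0 : 0 < e / (2 * t + 1) / 2 by rewrite !divr_gt0 //; lra.
have [d d0 Hd] := @unif_cont_segment _ _ g 0 t _ cg e'0.
have M1 : 0 < 2 * M + 1 by lra.
exists (Num.min d (e / (2 * M + 1))); first by rewrite lt_min d0 divr_gt0.
move=> u /andP[u0 ut]; rewrite lt_min ltr_pdivlMr // => /andP[tu1 tu2].
apply: le_lt_trans (@rnorm_bochner0tB_le g g t u M _ cg cg t0 u0 M0 (ltW e'0) _ _) _.
- move=> c /andP[c0 c1]; apply/ltW/Hd.
  + by rewrite mulr_ge0 //= ler_piMl.
  + by rewrite mulr_ge0 //= (le_trans _ ut) // ler_piMl.
  + rewrite -mulrBr normrM !ger0_norm ?subr_ge0 //.
    by apply: le_lt_trans tu1; rewrite ler_piMl ?subr_ge0.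
- by move=> s /andP[s0 su]; apply: HM; rewrite s0 (le_trans su).
rewrite ger0_norm ?subr_ge0 //.
have : t * (e / (2 * t + 1) / 2) <= e / 4.
  rewrite !mulrA ler_pdivrMr // ler_pdivrMr //; last lra.
  by nra.
by nra.
Qed.

(* The identity is exact for commensurable t and s; the general case follows by
   approximating s by multiples of t / p, p -> oo. *)
Lemma bochner0t_cat g t s : continuous g -> 0 <= t -> 0 <= s ->
  bochner0t g (t + s) = bochner0t g t + bochner0t (fun u => g (t + u)) s.
Proof.
move=> cg t0 s0; move: (t0); rewrite le_eqVlt => /predU1P[<-|tp].
  rewrite add0r bochner0t_0 add0r; apply: eq_bochner0t => // u _.
  by rewrite add0r.
apply/subr0_eq; apply: rnorm_small => e e0.
have c2 := continuous_comp_addl (a := t) cg.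
have e20 : 0 < e / 2 by rewrite divr_gt0.
have [d1 d10 Hd1] := bochner0t_left_continuous cg (addr_ge0 t0 s0) e20.
have [d2 d20 Hd2] := bochner0t_left_continuous c2 s0 e20.
have d0 : 0 < Num.min d1 d2 by rewrite lt_min d10.
have [p /(_ p.+1 (ltnSn p))] := inv_nat_small t0 d0.
set h := t / p.+1%:R => hd.
have h0 : 0 < h by rewrite divr_gt0.
have th : t = p.+1%:R * h by rewrite mulrC divfK // pnatr_eq0.
pose q := Num.trunc (s / h).
have /andP[qs sq] : q%:R <= s / h < q.+1%:R by apply/truncn_itv/divr_ge0/ltW.
move: qs sq; rewrite ler_pdivlMr // ltr_pdivrMr // -natr1 mulrDl mul1r => qs sq.
have qh0 : 0 <= q%:R * h by rewrite mulr_ge0 // ltW.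
have := @bochner0t_cat_commensurable g h p.+1 q cg (ltW h0).
rewrite -th => E.
have H1 : rnorm (bochner0t g (t + s) - bochner0t g (t + q%:R * h)) < e / 2.
  apply: Hd1; first by lra.
  by move: hd; rewrite lt_min => /andP[? ?]; lra.
have H2 : rnorm (bochner0t (fun u => g (t + u)) s -
                 bochner0t (fun u => g (t + u)) (q%:R * h)) < e / 2.
  apply: Hd2; first by lra.
  by move: hd; rewrite lt_min => /andP[? ?]; lra.
rewrite E in H1.
set I1 := bochner0t g (t + s) in H1 *; set I2 := bochner0t g t in H1 *.
set I3 := bochner0t _ s in H2 *; set I4 := bochner0t _ (q%:R * h) in H1 H2 *.
have -> : I1 - (I2 + I3) = (I1 - (I2 + I4)) - (I3 - I4).
  by rewrite opprB !opprD !addrA subrK.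
by apply: le_trans (rnormD _ _) _; rewrite rnormN; lra.
Qed.

(** First-order expansion at 0, the form in which derivatives of integrals are used below. *)
Lemma bochner0t_small g e : continuous g -> 0 < e ->
  exists2 d, 0 < d & forall h, 0 <= h < d ->
    rnorm (bochner0t g h - ofR h *: g 0) <= h * e.
Proof.
move=> cg e0; have [d d0 Hd] := @unif_cont_segment _ _ g 0 1 _ cg e0.
exists (Num.min d 1); first by rewrite lt_min d0 ltr01.
move=> h /andP[h0]; rewrite lt_min => /andP[hd h1].
rewrite -bochner0t_cst -bochner0tB //; last by move=> x; exact: cvg_cst.
apply: rnorm_bochner0t_le => //; last 2 first.
- exact: ltW.
- move=> s /andP[s0 sh]; apply/ltW/Hd; rewrite ?lexx ?ler01 ?s0 /=; [lra|by []|].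
  by rewrite subr0 ger0_norm //; lra.
by move=> x; apply: cvgB; [exact: cg|exact: cvg_cst].
Qed.

End Integral.

(** * Uniform boundedness, a one-sided Gronwall inequality, an exponential estimate *)

Section Estimates.
Context {R : realType}.

(* Nested balls of radius at most 2^-n on which some member of the family
   exceeds n; the common point contradicts pointwise boundedness. *)
Lemma uniform_boundedness (H : completeNormedModType R[i]) (W : normedModType R[i])
    (I : Type) (F : I -> H -> W) :
  (forall i a x y, F i (a *: x + y) = a *: F i x + F i y) ->
  (forall i, exists M : R, forall x, rnorm (F i x) <= M * rnorm x) ->
  (forall x, exists M : R, forall i, rnorm (F i x) <= M) ->
  exists2 M : R, 0 <= M & forall i x, rnorm (F i x) <= M * rnorm x.
Proof.
move=> lF bF pF; apply: contrapT => nM.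
have FD i x y : F i (x + y) = F i x + F i y.
  by have := lF i 1 x y; rewrite !scale1r.
have F0 i : F i 0 = 0.
  by have := FD i 0 0; rewrite addr0 => /(congr1 (fun v => v - F i 0)); rewrite addrK subrr.
have FZ i a x : F i (a *: x) = a *: F i x by have := lF i a x 0; rewrite F0 !addr0.
have FN i x : F i (- x) = - F i x by rewrite -scaleN1r FZ scaleN1r.
(* From an index, a centre and a radius to the next centre and radius. The guard [0 < q.2] makes the
   relation total, as [choice] requires. *)
have step (q : nat * H * R) : exists p : H * R, 0 < q.2 ->
    [/\ 0 < p.2, p.2 <= q.2 / 2, rnorm (p.1 - q.1.2) <= q.2 / 2 &
     exists i, forall y, rnorm (y - p.1) <= p.2 -> q.1.1%:R <= rnorm (F i y)].
  case: q => [[n x] r] /=.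
  have [r0|r0] := ltP 0 r; last by exists (0, 0).
  pose K : R := n%:R + 1.
  have [i [v Hv]] : exists i, exists v, K / (r / 2) * rnorm v < rnorm (F i v).
    apply: contrapT => h; apply: nM; exists (K / (r / 2)).
      by rewrite divr_ge0 ?divr_ge0 ?(ltW r0) // /K addr_ge0.
    move=> i v; rewrite leNgt; apply/negP => hv; apply: h.
    by exists i, v.
  have v0 : 0 < rnorm v.
    rewrite lt_def rnorm_ge0 andbT; apply/eqP => /rnorm_eq0 v0.
    by move: Hv; rewrite v0 F0 !rnorm0 mulr0 ltxx.
  pose w := ofR (r / 2 / rnorm v) *: v.
  have wr : rnorm w = r / 2.
    rewrite rnormZ rnorm_ofR ger0_norm ?divr_ge0 ?(ltW r0) ?(ltW v0) //.
    by rewrite divfK // gt_eqF.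
  have Fw : K < rnorm (F i w).
    rewrite FZ rnormZ rnorm_ofR ger0_norm ?divr_ge0 ?(ltW r0) ?(ltW v0) //.
    rewrite [ltLHS](_ : _ = r / 2 / rnorm v * (K / (r / 2) * rnorm v)).
      by rewrite ltr_pM2l // !divr_gt0.
    by field; rewrite !gt_eqF.
  (* F(x + w) - F(x - w) = 2 F(w) has norm above [2 * K], so one of the points [x + w], [x - w] has
     an image of norm at least [K]. *)
  have [M HM] := bF i.
  have [y [yx Fy]] : exists y, rnorm (y - x) <= r / 2 /\ K <= rnorm (F i y).
    have [h|h] := leP K (rnorm (F i (x + w))).
      by exists (x + w); rewrite addrC addKr wr; split.
    exists (x - w); rewrite addrC addKr rnormN wr; split => //.
    have E : x + w + - (x - w) = ofR 2 *: w.
      by rewrite opprB addrC addrA subrK -mulr2n -scaler_nat ofRn.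
    have := rnormD (F i (x + w)) (F i (- (x - w))).
    by rewrite -FD E FZ FN rnormN rnormZ rnorm_ofR ger0_norm // => h2; lra.
  (* On a ball of radius (|M| + 1)^-1 the map [F i] varies by at most 1, which lowers the bound from
     [K], that is n + 1, to n. *)
  exists (y, Num.min (r / 2) (`|M| + 1)^-1) => _ /=.
  have M1 : 0 < `|M| + 1 by rewrite ltr_wpDl.
  split => //; first by rewrite lt_min divr_gt0 //= invr_gt0.
    by rewrite ge_min lexx.
  exists i => u; rewrite le_min => /andP[_ uy].
  have : rnorm (F i (u - y)) <= 1.
    apply: le_trans (HM _) _; apply: (@le_trans _ _ ((`|M| + 1) * rnorm (u - y))).
      by rewrite ler_wpM2r ?rnorm_ge0 //; have := ler_norm M; lra.
    by rewrite mulrC -ler_pdivlMr // mul1r.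
  have := rnormD (F i u) (F i (y - u)).
  rewrite -FD addrC subrK -[y - u]opprB FN rnormN.
  by move: Fy; rewrite /K; lra.
have [st Hst] := choice step.
pose xr := fix xr n : H * R := if n is n'.+1 then st (n', (xr n').1, (xr n').2) else (0, 1).
have r0 n : 0 < (xr n).2.
  by elim: n => [|n IH] /=; [exact: ltr01|have [] := Hst (n, (xr n).1, (xr n).2) IH].
have S n := Hst (n, (xr n).1, (xr n).2) (r0 n).
have nest n k y : rnorm (y - (xr (n + k)%N).1) <= (xr (n + k)%N).2 ->
    rnorm (y - (xr n).1) <= (xr n).2.
  elim: k => [|k IH]; first by rewrite addn0.
  rewrite addnS => h; apply: IH.
  have [_ h1 h2 _] := S (n + k)%N.
  have -> : y - (xr (n + k)%N).1 =
      (y - (xr (n + k).+1).1) + ((xr (n + k).+1).1 - (xr (n + k)%N).1).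
    by rewrite addrA subrK.
  by apply: le_trans (rnormD _ _) _; move: h h1 h2 => /=; lra.
have close n m : (n <= m)%N -> rnorm ((xr m).1 - (xr n).1) <= (xr n).2.
  move=> nm; apply: (nest _ (m - n)%N); rewrite subnKC // subrr rnorm0.
  exact/ltW.
have rsmall n : (xr n).2 * n.+1%:R <= 1.
  elim: n => [|n IH]; first by rewrite /= mulr1.
  have [_ h1 _ _] := S n; have rn := r0 n.
  have n0 : 0 <= n%:R :> R by [].
  apply: le_trans IH; apply: (@le_trans _ _ ((xr n).2 / 2 * n.+2%:R)).
    by rewrite ler_wpM2r.
  rewrite -mulrA ler_wpM2l ?(ltW rn) // -[n.+2%:R]natr1 -[n.+1%:R]natr1; lra.
have : cvg ((xr n).1 @[n --> \oo]).
  apply/cauchy_cvgP/cauchy_exP => e /gt0_ofR[d d0 ->{e}].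
  have [N /(_ N.+1 (ltnSn N)) HN] := inv_nat_small (@ler01 R) d0.
  exists (xr N).1.
  suff : \forall n \near \oo, ball (xr N).1 (ofR d) (xr n).1 by [].
  near=> n; rewrite -ball_normE /ball_ /= normE ltcR rnormB.
  have Nn : (N <= n)%N by near: n; exact: nbhs_infty_ge.
  apply: le_lt_trans (close _ _ Nn) (le_lt_trans _ HN).
  by rewrite ler_pdivlMr.
move=> /cvg_ex[l Hl].
have [M HM] := pF l.
(* The limit [l] lies in the ball of index [N.+1], where some [F i] has norm at least [N]; but [N]
   exceeds the bound [M] at [l]. *)
have /andP[_] := @truncn_itv _ `|M| (normr_ge0 _); set N := (Num.trunc `|M|).+1 => hN.
have [_ _ _ [i Hi]] := S N.
have : N%:R <= rnorm (F i l).
  apply: Hi; rewrite -/(xr N.+1).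
  have L : (xr n).1 - (xr N.+1).1 @[n --> \oo] --> l - (xr N.+1).1.
    by apply: cvgB => //; exact: cvg_cst.
  apply: (cvg_rnorm_le L); near=> n; apply: close.
  by near: n; exact: nbhs_infty_ge.
by have := HM i; have := ler_norm M; lra.
Unshelve. all: by end_near. Qed.

(** The barrier [psi] grows at rate [(C + 1) * psi], which is at least [C * rnorm p + e] wherever
    [rnorm p <= psi]. Hence the supremum of the times in [0, T] with [rnorm p <= psi] cannot lie
    before T. *)
Lemma right_gronwall (V : normedModType R[i]) (p : R -> V) (C : R) :
  continuous p -> p 0 = 0 -> 0 <= C ->
  (forall t e, 0 <= t -> 0 < e -> exists2 d, 0 < d & forall h, 0 <= h < d ->
     rnorm (p (t + h)) <= rnorm (p t) + h * (C * rnorm (p t) + e)) ->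
  forall t, 0 <= t -> p t = 0.
Proof.
move=> cp p0 C0 hp T T0; apply: rnorm_small => e0 e0pos.
pose e := e0 / expR ((C + 1) * T).
have epos : 0 < e by rewrite divr_gt0 ?expR_gt0.
pose psi t := e * expR ((C + 1) * t).
suff : rnorm (p T) <= psi T by rewrite /psi /e divfK // gt_eqF ?expR_gt0.
have cq : continuous (fun t => rnorm (p t) - psi t).
  move=> x; apply: cvgB.
    exact: (cvg_comp _ _ (cp x) (@continuous_rnorm _ V (p x))).
  apply: cvgMr; apply: continuous_comp; last exact: continuous_expR.
  by apply: cvgMr; exact: cvg_id.
pose A := [set t | 0 <= t <= T /\ rnorm (p t) - psi t <= 0].
have A0 : A 0.
  split; first by rewrite lexx.
  by rewrite p0 rnorm0 sub0r oppr_le0 /psi mulr_ge0 ?expR_ge0 // ltW.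
have ubA : ubound A T by move=> t [/andP[]].
have supA : has_sup A by split; [exists 0|exists T].
pose s := sup A.
have leS a : A a -> a <= s by exact: sup_upper_bound.
have s0 : 0 <= s by exact: leS.
have sT : s <= T by apply: ge_sup => //; exists 0.
(* The supremum belongs to [A]: by continuity, a positive value of [rnorm p - psi] at [s] would
   persist at points of [A] near [s]. *)
have Ds : rnorm (p s) - psi s <= 0.
  rewrite leNgt; apply/negP => Dpos.
  have /cvgrPdist_lt/(_ _ Dpos)[d /= d0 Hd] := cq s.
  have [a [/andP[a0 aT] Da]] := sup_adherent d0 supA.
  rewrite -/s => sa.
  have as_ : a <= s by apply: leS; split=> //; rewrite a0.
  have /Hd : `|s - a| < d by rewrite ger0_norm ?subr_ge0 //; lra.
  by rewrite ltr_norml => /andP[_]; lra.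
move: sT; rewrite le_eqVlt => /predU1P[<-|sT]; first by rewrite -subr_le0.
have [d d0 Hd] := hp s e s0 epos.
pose h := Num.min (d / 2) (T - s).
have h0 : 0 < h by rewrite lt_min divr_gt0 // subr_gt0.
have hd : h < d by rewrite gt_min; apply/orP; left; lra.
have hT : h <= T - s by rewrite ge_min lexx orbT.
have : A (s + h).
  split; first by apply/andP; split; lra.
  have /Hd h1 : 0 <= h < d by rewrite (ltW h0).
  have E : psi (s + h) = psi s * expR ((C + 1) * h).
    by rewrite /psi mulrDr expRD mulrA.
  have h2 : 1 + (C + 1) * h <= expR ((C + 1) * h) by exact: expR_ge1Dx.
  have eps : e <= psi s.
    rewrite /psi ler_pMr //; apply: le_trans (expR_ge1Dx _).
    by rewrite lerDl mulr_ge0 // addr_ge0.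
  have ps0 : 0 <= psi s by rewrite (le_trans _ eps) // ltW.
  rewrite subr_le0 E; apply: le_trans h1 _.
  apply: (@le_trans _ _ (psi s * (1 + (C + 1) * h))); last by rewrite ler_wpM2l.
  have h3 : C * rnorm (p s) + e <= (C + 1) * psi s.
    by rewrite mulrDl mul1r lerD // ler_wpM2l //; lra.
  have := ler_wpM2l (ltW h0) h3.
  have -> : psi s * (1 + (C + 1) * h) = psi s + h * ((C + 1) * psi s) by ring.
  by lra.
by move=> /leS; rewrite gerDl leNgt h0.
Qed.

(** Each term is dominated by [2 / l] times an increment of [f], and the increments telescope. The
    factor 2 pays for sampling the decreasing exponential at left endpoints. *)
Lemma bochner0t_exp_bound (H : completeNormedModType R[i]) (g : R -> H) (l c t : R) :
  continuous g -> 0 < l -> 0 <= c -> 0 <= t ->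
  (forall s, 0 <= s <= t -> rnorm (g s) <= c * expR (l * (t - s))) ->
  rnorm (bochner0t g t) <= 2 * c / l * expR (l * t).
Proof.
move=> cg l0 c0 t0 hg; apply: cvg_rnorm_le (riemann_sum_cvg cg t0) _.
(* For n beyond [N], y = l t / n is below 1, so that 1 - exp(-y) >= y / (1 + y) >= y / 2. *)
have [N HN] := inv_nat_small (mulr_ge0 (ltW l0) t0) (@ltr01 R).
near=> n.
have Nn : (N < n)%N by near: n; exact: nbhs_infty_ge.
have n0 : 0 < n%:R :> R by rewrite ltr0n (leq_ltn_trans _ Nn).
have y1 := HN n Nn.
pose f (k : nat) := - expR (l * (t - k%:R * t / n%:R)).
apply: le_trans (@rnorm_riemann_sum_le _ _ g t n
  (fun k => c * expR (l * (t - k%:R * t / n%:R))) t0 _) _.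
  by move=> k kn; apply: hg; exact: sample_in.
rewrite -mulr_sumr mulrCA -(big_mkord xpredT (fun k => expR (l * (t - k%:R * t / n%:R)))).
rewrite mulr_sumr.
apply: (@le_trans _ _ (c * \sum_(0 <= k < n) (2 / l * (f k.+1 - f k)))).
  rewrite ler_wpM2l // !big_mkord; apply: ler_sum => k _.
  rewrite /f -[k.+1%:R]natr1.
  set y := l * t / n%:R in y1.
  have y0 : 0 <= y by rewrite divr_ge0 // mulr_ge0 // ltW.
  set x := l * (t - k%:R * t / n%:R).
  have -> : l * (t - (k%:R + 1) * t / n%:R) = x - y by rewrite /x /y; field; rewrite gt_eqF.
  rewrite expRD expRN opprK.
  have ex := expR_gt0 x; have ey := expR_ge1Dx y.
  have a1 : (expR y)^-1 <= (1 + y)^-1 by rewrite lef_pV2 // posrE ?expR_gt0 // ltr_wpDr.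
  have E : (1 + y)^-1 = 1 - y / (1 + y) by field; rewrite gt_eqF // ltr_wpDr.
  have a2 : y / 2 <= y / (1 + y) by rewrite ler_wpM2l // lef_pV2 ?posrE ?ltr_wpDr //; lra.
  have a3 : y <= 2 * (1 - (expR y)^-1) by move: a1; rewrite {}E; lra.
  have -> : t / n%:R = y / l by rewrite /y; field; rewrite !gt_eqF.
  rewrite [X in _ <= X](_ : _ = 2 * (1 - (expR y)^-1) * expR x / l);
    last by field; rewrite !gt_eqF ?expR_gt0.
  rewrite mulrAC ler_pM2r ?invr_gt0 //.
  by rewrite ler_pM2r.
rewrite -mulr_sumr telescope_sumr // /f mul0r mul0r subr0 opprK mulrA.
rewrite [c * _]mulrA [c * 2]mulrC ler_wpM2l //.
  by rewrite divr_ge0 ?mulr_ge0 // ltW.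
by rewrite gerDr oppr_le0 expR_ge0.
Unshelve. all: by end_near. Qed.

End Estimates.

(** * Inner product identities and the Cauchy-Schwarz inequality *)

Section InnerProduct.
Context {R : realType} {H : normedModType R[i]} {ip : H -> H -> R[i]}.
Hypothesis hip : is_inner_product ip.

Lemma ip_lin a x y w : ip (a *: x + y) w = a * ip x w + ip y w.
Proof. by case: hip. Qed.

Lemma ip_conj x y : ip y x = (ip x y)^*.
Proof. by case: hip. Qed.

Lemma ip_norm x : ip x x = `|x| ^+ 2.
Proof. by case: hip. Qed.

Lemma ipDl x y w : ip (x + y) w = ip x w + ip y w.
Proof. by have := ip_lin 1 x y w; rewrite scale1r mul1r. Qed.

Lemma ip0l w : ip 0 w = 0.
Proof.
by have := ipDl 0 0 w; rewrite addr0 => /(congr1 (fun v => v - ip 0 w)); rewrite addrK subrr.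
Qed.

Lemma ipZl a x w : ip (a *: x) w = a * ip x w.
Proof. by have := ip_lin a x 0 w; rewrite ip0l !addr0. Qed.

Lemma ipBl x y w : ip (x - y) w = ip x w - ip y w.
Proof. by rewrite ipDl -scaleN1r ipZl mulN1r. Qed.

Lemma ipBr x y w : ip w (x - y) = ip w x - ip w y.
Proof. by rewrite ip_conj ipBl [LHS]rmorphB [in RHS]ip_conj [X in _ = _ - X]ip_conj. Qed.

Lemma ipZr a x w : ip w (a *: x) = a^* * ip w x.
Proof. by rewrite ip_conj ipZl [LHS]rmorphM [in RHS]ip_conj. Qed.

Lemma ip_neq0 x : x != 0 -> ip x x != 0.
Proof. by move=> x0; rewrite ip_norm expf_eq0 /= normr_eq0. Qed.

(** The squared norm of [N *: x - a *: y] expands to N times N (x, x) - |a|^2. The factor of [y]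
    comes first to match operator bounds of the form [M * rnorm x]. *)
Lemma cauchy_schwarz x y : rnorm (ip x y) <= rnorm y * rnorm x.
Proof.
have [->|y0] := eqVneq y 0.
  by rewrite ip_conj ip0l rmorph0 !rnorm0 mul0r.
set a := ip x y; set N := ip y y.
have N0 : 0 < N by rewrite /N ip_norm exprn_gt0 // normr_gt0.
have Nc : N^* = N by rewrite /N -ip_conj.
have : 0 <= ip (N *: x - a *: y) (N *: x - a *: y) by rewrite ip_norm exprn_ge0.
rewrite !(ipBl, ipBr) !(ipZl, ipZr) -/a -/N Nc (ip_conj x y) -/a.
rewrite [X in _ <= X](_ : _ = N * (N * ip x x - a * a^*)); last by ring.
rewrite pmulr_rge0 // subr_ge0 -normCK /N !ip_norm -exprMn.
by rewrite ler_pXn2r // ?nnegrE ?mulr_ge0 // !normE -ofRM lecR.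
Qed.

End InnerProduct.

(** * Convolution of a scalar kernel with a vector function; the Volterra equation *)

Section Convolution.
Context {R : realType} {H : completeNormedModType R[i]}.

Lemma rnorm_scaleB (V : normedModType R[i]) (a b : R[i]) (x y : V) :
  rnorm (a *: x - b *: y) <= rnorm (a - b) * rnorm x + rnorm b * rnorm (x - y).
Proof.
have -> : a *: x - b *: y = (a - b) *: x + b *: (x - y).
  by rewrite scalerBl scalerBr addrA subrK.
by apply: le_trans (rnormD _ _) _; rewrite !rnormZ.
Qed.

(** Composition with the retraction onto the half-line trades continuity within [0, +oo[ for
    continuity on [R], the form assumed by the integral lemmas. *)
Lemma continuous_max0 (T : topologicalType) (g : R -> T) :
  {within `[0, +oo[, continuous g} -> continuous (fun t : R => g (Num.max 0 t)).
Proof.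
move=> /subspace_continuousP cg x.
have A0 (y : R) : `[0, +oo[%classic (Num.max 0 y).
  have : 0 <= Num.max 0 y by rewrite le_max lexx.
  by move: (Num.max 0 y) => w w0; rewrite /= in_itv /= w0.
apply: (cvg_comp _ _ _ (cg (Num.max 0 x) (A0 x))) => B /= HB.
have cm : continuous (fun y : R => Num.max 0 y).
  move=> y; apply: (@continuous_max _ _ (fun=> 0) id y).
    exact: cvg_cst.
  exact: cvg_id.
by apply: (filterS _ (cm x _ HB : nbhs x _)) => y; apply.
Qed.

(** With [phi] = f(x, .) and [v] = U(.) z this is the integral term of u(x, t). *)
Definition conv0t (phi : R -> R[i]) (v : R -> H) (t : R) : H :=
  bochner0t (fun s => phi (t - s) *: v s) t.

Implicit Types (phi psi : R -> Cplx R) (v : R -> H) (t h e T A : R).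

Lemma conv_integrand_continuous phi v t :
  continuous phi -> continuous v -> continuous (fun s => (phi (t - s) : R[i]) *: v s).
Proof.
move=> cphi cv x; apply: cvgZ; last exact: cv.
apply: (@cvg_comp _ _ _ (fun s => t - s) phi _ (nbhs (t - x))); last exact: cphi.
by apply: cvgB; [exact: cvg_cst|exact: cvg_id].
Qed.

Lemma eq_conv (phi psi : R -> R[i]) v t : 0 <= t ->
  (forall s, 0 <= s <= t -> phi s = psi s) -> conv0t phi v t = conv0t psi v t.
Proof.
move=> t0 h; apply: eq_bochner0t => // s /andP[s0 st]; rewrite h //.
by rewrite subr_ge0 st /= gerBl.
Qed.

Lemma conv_lin (a : R[i]) phi psi v t : continuous phi -> continuous psi ->
  continuous v -> 0 <= t ->
  conv0t (fun s => a * (phi s : R[i]) + (psi s : R[i])) v t =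
  a *: conv0t phi v t + conv0t psi v t.
Proof.
move=> c1 c2 cv t0; rewrite /conv0t.
have k1 := conv_integrand_continuous (t := t) c1 cv.
have k2 := conv_integrand_continuous (t := t) c2 cv.
rewrite -bochner0tZ // -bochner0tD //; last first.
  by move=> x; apply: cvgZr; exact: k1.
by apply: eq_bochner0t => // s _; rewrite scalerDl scalerA.
Qed.

Lemma conv_cat phi v h t : continuous phi -> continuous v -> 0 <= h -> 0 <= t ->
  conv0t phi v (h + t) =
  conv0t (fun s => phi (t + s)) v h + conv0t phi (fun s => v (h + s)) t.
Proof.
move=> cphi cv h0 t0; rewrite /conv0t bochner0t_cat //; last exact: conv_integrand_continuous.
congr (_ + _); apply: eq_bochner0t => // s _.
  by rewrite [h + t]addrC addrA.
by congr (phi _ *: _); ring.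
Qed.

(** Used both for the operator [U h] and for the scalar functional of the Volterra equation. *)
Lemma conv_map (W : normedModType R[i]) (A : H -> W) M phi v t :
  (forall a x y, A (a *: x + y) = a *: A x + A y) ->
  (forall x, rnorm (A x) <= M * rnorm x) ->
  continuous phi -> continuous v -> 0 <= t ->
  bochner0t (fun s => (phi (t - s) : R[i]) *: A (v s)) t = A (conv0t phi v t).
Proof.
move=> lA bA cphi cv t0.
rewrite -(bochner0t_map lA bA (conv_integrand_continuous (t := t) cphi cv) t0).
apply: eq_bochner0t => // s _.
have A0 : A 0 = 0.
  have := bA 0; rewrite rnorm0 mulr0 => h.
  by apply: rnorm_eq0; apply/eqP; rewrite eq_le h rnorm_ge0.
by have := lA (phi (t - s)) (v s) 0; rewrite A0 !addr0.
Qed.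

Lemma conv_bound phi v t M N : continuous phi -> continuous v -> 0 <= t ->
  0 <= M -> 0 <= N ->
  (forall s, 0 <= s <= t -> rnorm (phi s) <= M) ->
  (forall s, 0 <= s <= t -> rnorm (v s) <= N) ->
  rnorm (conv0t phi v t) <= t * (M * N).
Proof.
move=> cphi cv t0 M0 N0 hM hN; apply: rnorm_bochner0t_le => //.
- exact: conv_integrand_continuous.
- exact: mulr_ge0.
- move=> s /andP[s0 st]; rewrite rnormZ ler_pM ?rnorm_ge0 //.
    by apply: hM; rewrite subr_ge0 st gerBl.
  by apply: hN; rewrite s0.
Qed.

(** The integrand itself depends on [h], so [bochner0t_small] does not apply; uniform continuity of
    both factors on [0, 1] replaces it. *)
Lemma conv_small phi v e : continuous phi -> continuous v -> 0 < e ->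
  exists2 d, 0 < d & forall h, 0 <= h < d ->
    rnorm (conv0t phi v h - ofR h *: (phi 0 *: v 0)) <= h * e.
Proof.
move=> cphi cv e0.
have [N N0 HN] := @bounded_segment _ _ v 0 1 cv.
pose M := rnorm (phi 0 : R[i]).
have M0 : 0 <= M := rnorm_ge0 _.
pose eta := e / (N + M + 1).
have D0 : 0 < N + M + 1 by lra.
have eta0 : 0 < eta by rewrite divr_gt0.
have [d1 d10 Hd1] := @unif_cont_segment _ _ phi 0 1 _ cphi eta0.
have [d2 d20 Hd2] := @unif_cont_segment _ _ v 0 1 _ cv eta0.
exists (Num.min (Num.min d1 d2) 1); first by rewrite !lt_min d10 d20 ltr01.
move=> h /andP[h0]; rewrite !lt_min => /andP[/andP[hd1 hd2] h1].
have k := conv_integrand_continuous (t := h) cphi cv.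
rewrite -bochner0t_cst -bochner0tB //; last by move=> x; exact: cvg_cst.
apply: rnorm_bochner0t_le => //; last 2 first.
- exact: ltW.
- move=> s /andP[s0 sh]; apply: le_trans (rnorm_scaleB _ _ _ _) _.
  have b1 : rnorm ((phi (h - s) : R[i]) - phi 0) <= eta.
    apply/ltW/Hd1; rewrite ?lexx ?ler01 //; first by apply/andP; split; lra.
    by rewrite subr0 ger0_norm; lra.
  have b2 : rnorm (v s - v 0) <= eta.
    apply/ltW/Hd2; rewrite ?lexx ?ler01 //; first by apply/andP; split; lra.
    by rewrite subr0 ger0_norm; lra.
  have b3 : rnorm (v s) <= N by apply: HN; apply/andP; split; lra.
  have -> : e = eta * N + M * eta + eta by rewrite /eta; field; rewrite gt_eqF.
  apply: ler_wpDr; first exact: ltW.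
  by apply: lerD; rewrite ler_pM ?rnorm_ge0.
by move=> x; apply: cvgB; [exact: k|exact: cvg_cst].
Qed.

(** The upper limit and the kernel both move with [t]; rescaling to [0, 1] compares the integrands
    at proportional points. *)
Lemma conv_continuous phi v : continuous phi -> continuous v ->
  continuous (fun t : R => conv0t phi v (Num.max 0 t)).
Proof.
move=> cphi cv t; apply/cvg_rnormP => e e0.
pose t0 := Num.max 0 t; pose T := t0 + 1.
have t00 : 0 <= t0 by rewrite le_max lexx.
have [M M0 HM] := @bounded_segment _ _ phi 0 T cphi.
have [N N0 HN] := @bounded_segment _ _ v 0 T cv.
(* Over a length at most [T], the integrand error [eta * N + M * eta] then contributes at most
   [e / 2]. *)
pose eta := e / 2 / (T * (N + M) + 1).
have T1 : 1 <= T by rewrite /T; lra.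
have D0 : 0 < T * (N + M) + 1 by rewrite ltr_wpDl // mulr_ge0; lra.
have eta0 : 0 < eta by rewrite !divr_gt0.
have [d1 d10 Hd1] := @unif_cont_segment _ _ phi 0 T _ cphi eta0.
have [d2 d20 Hd2] := @unif_cont_segment _ _ v 0 T _ cv eta0.
have MN0 : 0 < M * N + 1 by rewrite ltr_wpDl // mulr_ge0.
pose d := Num.min (Num.min (Num.min d1 d2) 1) (e / 2 / (M * N + 1)).
have d0 : 0 < d by rewrite !lt_min d10 d20 ltr01 /= !divr_gt0.
exists d => // u /= tu.
set u0 := Num.max 0 u.
have u00 : 0 <= u0 by rewrite le_max lexx.
have ut : `|u0 - t0| < d.
  apply: le_lt_trans tu; rewrite distrC /u0 /t0.
  case: (leP 0 t) => ht; case: (leP 0 u) => hu; rewrite ?subrr ?normr0 //.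
    by rewrite subr0 !ger0_norm //; lra.
  by rewrite sub0r normrN ger0_norm // ler0_norm; lra.
move: (ut); rewrite !lt_min => /andP[/andP[/andP[ut1 ut2] ut3] ut4].
have uT : u0 <= T by move: ut3; rewrite ltr_norml /T => /andP[]; lra.
have b c s : 0 <= c <= 1 -> 0 <= s <= T -> 0 <= c * s <= T.
  move=> /andP[c0 c1] /andP[s0 sT]; rewrite mulr_ge0 //=.
  by apply: le_trans sT; rewrite ler_piMl.
have dst c dd : 0 <= c <= 1 -> `|u0 - t0| < dd -> `|c * u0 - c * t0| < dd.
  move=> /andP[c0 c1] hd; rewrite -mulrBr normrM ger0_norm //.
  by apply: le_lt_trans hd; rewrite ler_piMl.
have ku := conv_integrand_continuous (t := u0) cphi cv.
have kt := conv_integrand_continuous (t := t0) cphi cv.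
have tT : 0 <= t0 <= T by rewrite t00 /T; lra.
have uT' : 0 <= u0 <= T by rewrite u00.
have e'0 : 0 <= eta * N + M * eta by rewrite addr_ge0 // mulr_ge0 // ltW.
apply: le_lt_trans (@rnorm_bochner0tB_le _ _ _ _ u0 t0 (M * N)
  (eta * N + M * eta) ku kt u00 t00 (mulr_ge0 M0 N0) e'0 _ _) _.
- move=> c c01; apply: le_trans (rnorm_scaleB _ _ _ _) _.
  have c01' : 0 <= 1 - c <= 1 by move/andP: c01 => [? ?]; apply/andP; split; lra.
  have -> : u0 - c * u0 = (1 - c) * u0 by ring.
  have -> : t0 - c * t0 = (1 - c) * t0 by ring.
  apply: lerD; rewrite ler_pM ?rnorm_ge0 //.
  + by apply/ltW/Hd1; [exact: b|exact: b|exact: dst].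
  + by apply/HN/b.
  + by apply/HM/b.
  + by apply/ltW/Hd2; [exact: b|exact: b|exact: dst].
- move=> s /andP[s0 st]; rewrite rnormZ ler_pM ?rnorm_ge0 //.
    by apply: HM; move/andP: tT => [? ?]; apply/andP; split; lra.
  by apply: HN; move/andP: tT => [? ?]; apply/andP; split; lra.
have -> : e = e / 2 + e / 2 by field.
apply: ler_ltD.
  apply: (@le_trans _ _ (T * (eta * N + M * eta))); first by rewrite ler_wpM2r.
  rewrite (_ : T * _ = eta * (T * (N + M))); last by ring.
  rewrite /eta -[leRHS](@divfK _ (T * (N + M) + 1)) ?gt_eqF //.
  by rewrite ler_wpM2l ?lerDl // divr_ge0 ?divr_ge0 // ltW.
apply: (@le_lt_trans _ _ (`|u0 - t0| * (M * N + 1))); first by rewrite ler_wpM2l // lerDl.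
by rewrite -ltr_pdivlMr.
Qed.

(* The integral term is a contraction for the sup norm on [0, T] weighted by
   exp (- l t), once l is large. *)
Lemma volterra_bound (B : H -> Cplx R) (MB : R) v T :
  (forall x, rnorm (B x) <= MB * rnorm x) -> continuous v -> 0 <= T ->
  exists2 K : R, 0 <= K & forall phi A, continuous phi -> 0 <= A ->
    (forall t, 0 <= t <= T -> rnorm (phi t + B (conv0t phi v t)) <= A) ->
    forall t, 0 <= t <= T -> rnorm (phi t) <= K * A.
Proof.
move=> bB cv T0.
have [N N0 HN] := @bounded_segment _ _ v 0 T cv.
pose MB' := `|MB|.
have MB0 : 0 <= MB' by exact: normr_ge0.
have bB' x : rnorm (B x) <= MB' * rnorm x.
  by apply: le_trans (bB x) _; rewrite ler_wpM2r ?rnorm_ge0 // ler_norm.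
(* Makes [2 * MB' * N / l] at most 1/2, so the integral term takes up at most half of the weighted
   maximum [m]; the summand 1 keeps [l] positive. *)
pose l := 4 * MB' * N + 1.
have l0 : 0 < l by rewrite /l ltr_wpDl // !mulr_ge0.
exists (2 * expR (l * T)); first by rewrite mulr_ge0 ?expR_ge0.
move=> phi A cphi A0 hA.
have [|c cT Hc] := @EVT_max _ (fun t => rnorm (phi t) * expR (- (l * t))) 0 T T0.
  apply: continuous_subspaceT => x; apply: cvgM.
    exact: (cvg_comp _ _ (cphi x) (@continuous_rnorm _ (Cplx R) (phi x))).
  apply: continuous_comp; last exact: continuous_expR.
  by apply: cvgN; apply: cvgMr; exact: cvg_id.
pose m := rnorm (phi c) * expR (- (l * c)).
have m0 : 0 <= m by rewrite mulr_ge0 ?rnorm_ge0 ?expR_ge0.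
have phim t : 0 <= t <= T -> rnorm (phi t) <= m * expR (l * t).
  move=> tT; rewrite -ler_pdivrMr ?expR_gt0 // -expRN.
  by apply: Hc; rewrite in_itv.
have key t : 0 <= t <= T -> rnorm (phi t) <= A + m / 2 * expR (l * t).
  move=> tT; have [t0 t1] := andP tT.
  have h1 : rnorm (conv0t phi v t) <= 2 * (m * N) / l * expR (l * t).
    apply: bochner0t_exp_bound => //.
    - exact: conv_integrand_continuous.
    - exact: mulr_ge0.
    - move=> s /andP[s0 st]; rewrite rnormZ mulrAC ler_pM ?rnorm_ge0 //.
        by apply: phim; apply/andP; split; lra.
      by apply: HN; apply/andP; split; lra.
  have h2 : MB' * rnorm (conv0t phi v t) <= m / 2 * expR (l * t).
    apply: le_trans (ler_wpM2l MB0 h1) _.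
    rewrite [leLHS]mulrA; apply: ler_wpM2r; first exact: expR_ge0.
    rewrite [leLHS]mulrA ler_pdivrMr // /l.
    rewrite (_ : MB' * (2 * (m * N)) = m / 2 * (4 * MB' * N)); last by field.
    by rewrite ler_wpM2l ?divr_ge0 // lerDl.
  have -> : phi t = (phi t + B (conv0t phi v t)) - B (conv0t phi v t) by rewrite addrK.
  apply: le_trans (rnormD _ _) _; rewrite rnormN; apply: lerD; first exact: hA.
  exact: le_trans (bB' _) h2.
(* At the maximum point [c], [key] becomes m <= A exp(-l c) + m / 2. *)
have m2 : m <= 2 * A.
  have cT' : 0 <= c <= T by move: cT; rewrite in_itv.
  have := key c cT'.
  have E : expR (l * c) * expR (- (l * c)) = 1 by rewrite -expRD subrr expR0.
  rewrite -(ler_pM2r (expR_gt0 (- (l * c)))) -/m mulrDl -[_ / 2 * _ * _]mulrA E mulr1.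
  have : A * expR (- (l * c)) <= A.
    rewrite ler_piMr // -[leRHS]expR0 ler_expR oppr_le0 mulr_ge0 ?(ltW l0) //.
    by case/andP: cT'.
  by lra.
move=> t tT; apply: le_trans (phim t tT) _.
have E : expR (l * t) <= expR (l * T).
  by rewrite ler_expR ler_wpM2l ?(ltW l0) //; case/andP: tT.
by apply: le_trans (ler_pM m0 (expR_ge0 _) m2 E) _; rewrite [leLHS]mulrAC.
Qed.

End Convolution.

(** * Orbits and generator of a strongly continuous semigroup *)

Section Semigroup.
Context {R : realType} {H : completeNormedModType R[i]} {U : R -> H -> H}.
Hypothesis Ulin : forall t a x y, U t (a *: x + y) = a *: U t x + U t y.
Hypothesis Ubdd : forall t, exists M : R, forall x, rnorm (U t x) <= M * rnorm x.
Hypothesis U0 : forall x, U 0 x = x.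
Hypothesis UD : forall (s t : R) x, 0 <= s -> 0 <= t -> U (s + t) x = U s (U t x).
Hypothesis Uc : forall x, continuous (fun t => U t x).

(** Continuous orbits are bounded on [0, T], so uniform boundedness applies to the family indexed by
    that segment. *)
Lemma semigroup_locally_bounded (T : R) :
  exists2 M : R, 0 <= M & forall t x, 0 <= t <= T -> rnorm (U t x) <= M * rnorm x.
Proof.
have [i|i|x|M M0 HM] := @uniform_boundedness R H H {t : R | 0 <= t <= T}
  (fun t => U (sval t)).
- exact: Ulin.
- exact: Ubdd.
- have [M _ HM] := @bounded_segment _ _ _ 0 T (@Uc x).
  by exists M => -[t tT]; exact: HM.
by exists M => // t x tT; exact: (HM (exist _ t tT)).
Qed.

Lemma semigroup_sub t x y : U t (x - y) = U t x - U t y.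
Proof. by rewrite -scaleN1r addrC Ulin scaleN1r addrC. Qed.

(** [U h] shifts the window of integration. Everything cancels except two pieces of length [h],
    whose averages converge to [U t y] and [y]. *)
Lemma integral_in_generator_domain (y : H) (t : R) : 0 <= t ->
  diff_quot U (bochner0t (fun s => U s y) t) h @[h --> 0^'+] --> U t y - y.
Proof.
move=> t0; apply/cvg_rnormP => e e0.
have e'0 : 0 < e / 3 by rewrite divr_gt0.
have [d1 d10 H1] := bochner0t_small (@Uc (U t y)) e'0.
have [d2 d20 H2] := bochner0t_small (@Uc y) e'0.
near=> h.
have h0 : 0 < h by near: h; exact: nbhs_right_gt.
have hd1 : h < d1 by near: h; exact: nbhs_right_lt.
have hd2 : h < d2 by near: h; exact: nbhs_right_lt.
have {}H1 := H1 h; rewrite (ltW h0) hd1 U0 in H1; have {}H1 := H1 isT.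
have {}H2 := H2 h; rewrite (ltW h0) hd2 U0 in H2; have {}H2 := H2 isT.
set A := bochner0t (fun s => U s (U t y)) h in H1.
set B := bochner0t (fun s => U s y) h in H2.
set J := bochner0t (fun s => U s y) t.
have UJ : U h J = bochner0t (fun s => U (h + s) y) t.
  have [M HM] := Ubdd h.
  rewrite -(bochner0t_map (@Ulin h) HM (@Uc y) t0).
  by apply: eq_bochner0t => // s /andP[s0 _]; rewrite UD // ltW.
have C1 := bochner0t_cat (@Uc y) (ltW h0) t0.
have C2 := bochner0t_cat (@Uc y) t0 (ltW h0).
have EA : bochner0t (fun s => U (t + s) y) h = A.
  by apply: eq_bochner0t (ltW h0) _ => s /andP[s0 _]; rewrite addrC UD.
(* From the two splittings [C1] and [C2] of the same integral, at [h] and at [t]. *)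
have E : U h J - J = A - B.
  apply/eqP; rewrite subr_eq addrAC eq_sym subr_eq UJ -EA; apply/eqP.
  by rewrite [RHS]addrC -/B -C1 [h + t]addrC C2 addrC.
rewrite /diff_quot -/J E.
have -> : ofR h^-1 *: (A - B) - (U t y - y) =
    ofR h^-1 *: ((A - ofR h *: U t y) - (B - ofR h *: y)).
  have -> : U t y - y = ofR h^-1 *: (ofR h *: (U t y - y)).
    by rewrite scalerA -ofRM mulVf ?gt_eqF // ofR1 scale1r.
  rewrite -scalerBr; congr (_ *: _).
  by rewrite scalerBr !opprB addrACA [RHS]addrACA; congr (_ + _); exact: addrC.
rewrite rnormZ rnorm_ofR ger0_norm ?invr_ge0 ?(ltW h0) //.
rewrite mulrC ltr_pdivrMr //; apply: le_lt_trans (rnormD _ _) _; rewrite rnormN.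
by rewrite mulrC; nra.
Unshelve. all: by end_near. Qed.

(** Beyond [h] the operator [U h] factors out of the integrand; the piece over [0, h] keeps the
    kernel shifted by [t]. *)
Lemma conv_semigroup (phi : R -> Cplx R) (z : H) (h t : R) :
  continuous phi -> 0 <= h -> 0 <= t ->
  conv0t phi (fun s => U s z) (h + t) =
  U h (conv0t phi (fun s => U s z) t) + conv0t (fun s => phi (t + s)) (fun s => U s z) h.
Proof.
move=> cphi h0 t0; rewrite conv_cat // addrC; congr (_ + _).
have [M HM] := Ubdd h.
rewrite -(conv_map (@Ulin h) HM cphi (@Uc z) t0).
by apply: eq_bochner0t => // s /andP[s0 _]; rewrite UD.
Qed.

End Semigroup.

(** Here [w] stands for L^dagger z itself: the projection and the division by (z, z) are built in.
    Applied to U(t) Q x and to U(s) z it gives both coefficients of the equation for f. *)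
Definition memory_functional (R : realType) (H : normedModType R[i])
    (ip : H -> H -> R[i]) (z w x : H) : Cplx R :=
  ip x (projQ ip z w) / ip z z.

(** * The projected dynamics: orthogonality, uniqueness, semigroup law, boundedness *)

Section ProjectedDynamics.
Context {R : realType} {H : completeNormedModType R[i]} {U : R -> H -> H}.
Hypothesis Ulin : forall t a x y, U t (a *: x + y) = a *: U t x + U t y.
Hypothesis Ubdd : forall t, exists M : R, forall x, rnorm (U t x) <= M * rnorm x.
Hypothesis U0 : forall x, U 0 x = x.
Hypothesis UD : forall (s t : R) x, 0 <= s -> 0 <= t -> U (s + t) x = U s (U t x).
Hypothesis Uc : forall x, continuous (fun t => U t x).
Context {ip : H -> H -> R[i]} {z Ldz : H}.
Hypothesis hip : is_inner_product ip.
Hypothesis z0 : z != 0.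
Hypothesis adj : forall x v,
  diff_quot U x h @[h --> 0^'+] --> v -> ip v z = ip x Ldz.

Let N := ip z z.
Let P := projP ip z.
Let Q := projQ ip z.
Let v (s : R) := U s z.

Let N0 : N != 0. Proof. exact: (ip_neq0 hip). Qed.

Let B := memory_functional ip z Ldz.

Lemma memory_functional_lin a x y : B (a *: x + y) = a *: B x + B y.
Proof. by rewrite /B /memory_functional (ip_lin hip) mulrDl -mulrA. Qed.

Lemma memory_functionalB x y : B (x - y) = B x - B y.
Proof. by rewrite /B /memory_functional (ipBl hip) mulrBl. Qed.

Let MB : R := rnorm (projQ ip z Ldz) * rnorm (N^-1).

Lemma memory_functional_bound x : rnorm (B x) <= MB * rnorm x.
Proof.
rewrite /B /memory_functional [leLHS]rnormM -/N /MB mulrAC ler_wpM2r ?rnorm_ge0 //.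
exact: (cauchy_schwarz hip).
Qed.

Lemma continuous_ip (w : H) : continuous (fun x => ip x w : Cplx R).
Proof.
move=> x; apply/cvg_rnormP => e e0.
have W0 : 0 < rnorm w + 1 by rewrite ltr_wpDl ?rnorm_ge0.
have /cvg_rnormP/(_ _ (divr_gt0 e0 W0)) : (y : H) @[y --> x] --> x by exact: cvg_id.
apply: filterS => y; rewrite ltr_pdivlMr // => h.
have -> : (ip y w : Cplx R) - ip x w = ip (y - x) w by rewrite (ipBl hip).
apply: le_lt_trans (cauchy_schwarz hip _ _) (le_lt_trans _ h).
by rewrite mulrC ler_wpM2l ?rnorm_ge0 // lerDl.
Qed.

Lemma ip_proj x : ip (P x) z = ip x z.
Proof. by rewrite /P /projP (ipZl hip) divfK. Qed.

Lemma ip_projQ x : ip (Q x) z = 0.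
Proof. by rewrite /Q /projQ (ipBl hip) -/(P x) ip_proj subrr. Qed.

Lemma projP_lin a x y : P (a *: x + y) = a *: P x + P y.
Proof. by rewrite /P /projP (ip_lin hip) mulrDl scalerDl scalerA mulrA. Qed.

Lemma projQ_lin a x y : Q (a *: x + y) = a *: Q x + Q y.
Proof. by rewrite /Q /projQ -!/(P _) projP_lin scalerBr opprD addrACA. Qed.

(** The integrated form of d/dt (U(t) y, z) = (U(t) y, L^dagger z), valid for every [y], since [adj]
    is applied to the integral of the orbit, which lies in the domain. *)
Lemma semigroup_adjoint (y : H) (t : R) : 0 <= t ->
  ip (U t y) z = ip y z + ip (bochner0t (fun s => U s y) t) Ldz.
Proof.
move=> t0.
rewrite -(adj (integral_in_generator_domain Ulin Ubdd U0 UD Uc (y := y) t0)) (ipBl hip).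
by rewrite addrC subrK.
Qed.

Context {F : H -> R -> Cplx R}.
Hypothesis Fc : forall x, continuous (F x).
Hypothesis Feq : forall x t, 0 <= t -> F x t = B (U t (Q x)) - B (conv0t (F x) v t).

Let Y x (t : R) := U t (Q x) - conv0t (F x) v t.

Lemma memory_dynamicsE x t : 0 <= t -> F x t = B (Y x t).
Proof. by move=> t0; rewrite /Y memory_functionalB Feq. Qed.

Lemma orthogonal_dynamicsD x h t : 0 <= h -> 0 <= t ->
  Y x (h + t) = U h (Y x t) - conv0t (fun s => F x (t + s)) v h.
Proof.
move=> h0 t0; rewrite /Y UD // (conv_semigroup Ulin Ubdd UD Uc) //.
by rewrite (semigroup_sub Ulin h (U t (Q x))) opprD addrA.
Qed.

(* The component along z solves the scalar equation p' = kappa p from the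
   right, with p 0 = 0. *)
Lemma orthogonal_dynamics_orthogonal x t : 0 <= t -> ip (Y x t) z = 0.
Proof.
(* The convolution is controlled at nonnegative times only; truncation gives a function continuous
   on all of [R]. *)
pose p (t : R) : Cplx R := ip (U t (Q x) - conv0t (F x) v (Num.max 0 t)) z.
have pE s : 0 <= s -> p s = ip (Y x s) z by move=> s0; rewrite /p max_r.
have cp : continuous p.
  move=> s; apply: (@cvg_comp _ _ _ _ (fun y => ip y z : Cplx R) _
    (nbhs (U s (Q x) - conv0t (F x) v (Num.max 0 s)))); last exact: continuous_ip.
  by apply: cvgB; [exact: Uc|exact: (conv_continuous (@Fc x) (@Uc z))].
have p0 : p 0 = 0.
  by rewrite pE // /Y U0 /conv0t bochner0t_0 subr0 ip_projQ.
(* This constant comes from (y, Q L^dagger z) = (y, L^dagger z) - kappa (y, z). *)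
pose kappa : R[i] := (ip Ldz z / N)^*.
suff h : forall t, 0 <= t -> p t = 0 by move=> t0; rewrite -pE // h.
apply: (@right_gronwall R (Cplx R) p (rnorm kappa) cp p0 (rnorm_ge0 _)).
move=> {}t e t0 e0.
pose e' := e / (rnorm Ldz + rnorm z + 1).
have D0 : 0 < rnorm Ldz + rnorm z + 1 by rewrite ltr_wpDl // addr_ge0 ?rnorm_ge0.
have e'0 : 0 < e' by rewrite divr_gt0.
have cF : continuous (fun s => F x (t + s)) := continuous_comp_addl (a := t) (@Fc x).
have [d1 d10 H1] := bochner0t_small (@Uc (Y x t)) e'0.
have [d2 d20 H2] := conv_small cF (@Uc z) e'0.
exists (Num.min d1 d2); first by rewrite lt_min d10.
move=> h /andP[h0]; rewrite lt_min => /andP[hd1 hd2].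
have {}H1 := H1 h; rewrite h0 hd1 U0 in H1; have {}H1 := H1 isT.
have {}H2 := H2 h; rewrite h0 hd2 U0 addr0 in H2; have {}H2 := H2 isT.
rewrite !pE ?addr_ge0 // addrC orthogonal_dynamicsD //.
set K := conv0t _ v h; rewrite -/v -/K in H2.
rewrite (ipBl hip) semigroup_adjoint //.
set J := bochner0t _ h in H1 *.
set y := Y x t in H1 *.
(* To first order [J] is h y and [K] is h F(x, t) z. The resulting term h ((y, L^dagger z) - F(x, t)
   (z, z)) is h kappa (y, z) by [Fy]; the second bracket is the remainder. *)
have -> : ip y z + ip J Ldz - ip K z =
    (ip y z + ofR h * (kappa * ip y z)) +
    (ip (J - ofR h *: y) Ldz - ip (K - ofR h *: (F x t *: z)) z).
  have Fy : F x t * N = ip y Ldz - kappa * ip y z.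
    rewrite memory_dynamicsE // /B /memory_functional -/N divfK // /projQ (ipBr hip).
    by rewrite /projP (ipZr hip).
  rewrite (ipBl hip J) (ipBl hip K) !(ipZl hip) -/N Fy.
  by ring.
apply: le_trans (rnormD _ _) _.
have a1 : rnorm (ip y z + ofR h * (kappa * ip y z)) <=
    rnorm (ip y z) + h * (rnorm kappa * rnorm (ip y z)).
  by apply: le_trans (rnormD _ _) _; rewrite !rnormM rnorm_ofR ger0_norm.
have a2 : rnorm (ip (J - ofR h *: y) Ldz - ip (K - ofR h *: (F x t *: z)) z) <= h * e.
  apply: le_trans (rnormD _ _) _; rewrite rnormN.
  apply: (@le_trans _ _ (rnorm Ldz * (h * e') + rnorm z * (h * e'))).
    apply: lerD; apply: le_trans (cauchy_schwarz hip _ _) _;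
    by rewrite ler_wpM2l ?rnorm_ge0.
  have -> : e = e' * (rnorm Ldz + rnorm z + 1) by rewrite /e' divfK // gt_eqF.
  have := mulr_ge0 h0 (ltW e'0); lra.
by rewrite mulrDr addrA lerD.
Qed.

Let G (t : R) x := P x + U t (Q x) - conv0t (F x) v t.

Lemma projected_dynamicsE t x : G t x = P x + Y x t.
Proof. by rewrite /G /Y addrA. Qed.

Lemma projP_dynamics t x : 0 <= t -> P (G t x) = P x.
Proof.
move=> t0; rewrite projected_dynamicsE /P /projP.
by rewrite (ipDl hip) orthogonal_dynamics_orthogonal // addr0 ip_proj.
Qed.

Lemma projQ_dynamics t x : 0 <= t -> Q (G t x) = Y x t.
Proof.
move=> t0; rewrite /Q /projQ -/(P _) projP_dynamics //.
by rewrite projected_dynamicsE addrC addKr.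
Qed.

(** The a priori bound with [A = 0] leaves only the zero solution. *)
Lemma volterra_unique (phi : R -> Cplx R) :
  continuous phi -> (forall t, 0 <= t -> phi t = - B (conv0t phi v t)) ->
  forall t, 0 <= t -> phi t = 0.
Proof.
move=> cphi h t t0.
have [K _ HK] := volterra_bound memory_functional_bound (@Uc z) t0.
apply: rnorm_small => e e0; apply: (@le_trans _ _ 0); last exact: ltW.
rewrite -(mulr0 K); apply: HK => //; last by rewrite t0 lexx.
by move=> s /andP[s0 _]; rewrite (h s s0) addNr rnorm0.
Qed.

(** In [s], both sides solve the Volterra equation with inhomogeneous term [B (U s (Y x t))],
    because [Q (G t x)] is [Y x t]. Their difference solves the homogeneous one. *)
Lemma memory_shift t x s : 0 <= t -> 0 <= s -> F x (t + s) = F (G t x) s.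
Proof.
move=> t0 s0; apply/eqP; rewrite -subr_eq0; apply/eqP.
pose phi (s : R) : Cplx R := F x (t + s) - F (G t x) s.
suff : phi s = 0 by [].
have cF : continuous (fun s => F x (t + s)) := continuous_comp_addl (a := t) (@Fc x).
apply: volterra_unique s0 => {s} [s|s s0].
  by apply: cvgB; [exact: cF|exact: Fc].
have -> : conv0t phi v s = conv0t (fun s => F x (t + s)) v s - conv0t (F (G t x)) v s.
  have := conv_lin (-1) (@Fc (G t x)) cF (@Uc z) s0.
  rewrite scaleN1r addrC => <-; apply: eq_conv => // r _.
  by rewrite mulN1r addrC.
have E1 : F x (t + s) = B (U s (Y x t)) - B (conv0t (fun s => F x (t + s)) v s).
  by rewrite addrC memory_dynamicsE ?addr_ge0 // orthogonal_dynamicsD // memory_functionalB.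
have E2 : F (G t x) s = B (U s (Y x t)) - B (conv0t (F (G t x)) v s).
  by rewrite Feq // projQ_dynamics.
by rewrite memory_functionalB opprB /phi E1 E2 opprB [LHS]addrC addrA subrK.
Qed.

(** Both sides have the component [P x] along [z]; the orthogonal components agree by
    [orthogonal_dynamicsD] once [memory_shift] identifies the kernels. *)
Lemma dynamicsD s t x : 0 <= s -> 0 <= t -> G (s + t) x = G s (G t x).
Proof.
move=> s0 t0; rewrite [LHS]projected_dynamicsE [RHS]projected_dynamicsE orthogonal_dynamicsD //.
rewrite projP_dynamics // [in RHS]/Y projQ_dynamics //; congr (_ + (_ - _)).
by apply: eq_conv => // r /andP[r0 _]; rewrite memory_shift.
Qed.

(** The inhomogeneous term [B (U t (Q x))] is linear in [x], so the defect of linearity solves the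
    homogeneous Volterra equation. *)
Lemma memory_lin a x y t : 0 <= t -> F (a *: x + y) t = a * F x t + F y t.
Proof.
move=> t0; apply/eqP; rewrite -subr_eq0; apply/eqP.
pose lin (s : R) : Cplx R := a * F x s + F y s.
pose phi (s : R) : Cplx R := F (a *: x + y) s - lin s.
suff : phi t = 0 by [].
have cl : continuous lin.
  by move=> s; apply: cvgD; [apply: cvgZr; exact: Fc|exact: Fc].
apply: volterra_unique t0 => {t} [s|t t0].
  by apply: cvgB; [exact: Fc|exact: cl].
have -> : conv0t phi v t = conv0t (F (a *: x + y)) v t - (a *: conv0t (F x) v t + conv0t (F y) v t).
  rewrite -(conv_lin a (@Fc x) (@Fc y) (@Uc z) t0) [RHS]addrC.
  have := conv_lin (-1) cl (@Fc (a *: x + y)) (@Uc z) t0.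
  rewrite scaleN1r => <-; apply: eq_conv => // r _.
  by rewrite mulN1r addrC.
rewrite memory_functionalB memory_functional_lin /phi /lin !Feq // projQ_lin Ulin.
rewrite memory_functional_lin.
have E (b1 b2 c0 c1 c2 : R[i]) :
    a * b1 + b2 - c0 - (a * (b1 - c1) + (b2 - c2)) = - (c0 - (a * c1 + c2)) by ring.
exact: E.
Qed.

Lemma dynamics_lin t a x y : 0 <= t -> G t (a *: x + y) = a *: G t x + G t y.
Proof.
move=> t0; rewrite /G projP_lin projQ_lin Ulin.
rewrite (@eq_conv _ _ (F (a *: x + y)) (fun s => a * F x s + F y s)) //; last first.
  by move=> s /andP[s0 _]; exact: memory_lin.
rewrite (conv_lin a (@Fc x) (@Fc y) (@Uc z) t0).
by rewrite opprD [X in X + _ = _]addrACA [LHS]addrACA scalerBr scalerDr.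
Qed.

(** [A x] bounds the inhomogeneous term on [0, t], hence [K * A x] bounds the memory kernel there;
    every bound is a multiple of [rnorm x]. *)
Lemma dynamics_bounded t : 0 <= t ->
  exists M : R, forall x, rnorm (G t x) <= M * rnorm x.
Proof.
move=> t0.
have [M M0 HM] := semigroup_locally_bounded Ulin Ubdd Uc t.
have [K K0 HK] := volterra_bound memory_functional_bound (@Uc z) t0.
have MB0 : 0 <= MB by rewrite mulr_ge0 ?rnorm_ge0.
pose cP := rnorm z * rnorm N^-1 * rnorm z.
have cP0 : 0 <= cP by rewrite !mulr_ge0 ?rnorm_ge0.
have bP x : rnorm (P x) <= cP * rnorm x.
  have -> : cP * rnorm x = rnorm z * rnorm x * rnorm N^-1 * rnorm z by rewrite /cP; ring.
  rewrite /P /projP rnormZ rnormM -/N.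
  do 2 (apply: ler_wpM2r; first exact: rnorm_ge0).
  exact: (cauchy_schwarz hip).
pose cQ := 1 + cP.
have cQ0 : 0 <= cQ by rewrite addr_ge0.
have bQ x : rnorm (Q x) <= cQ * rnorm x.
  apply: le_trans (rnormD _ _) _; rewrite rnormN /cQ mulrDl mul1r lerD2l.
  exact: bP.
pose A (x : H) := MB * (M * (cQ * rnorm x)).
have A0 x : 0 <= A x by rewrite !mulr_ge0 ?rnorm_ge0.
have bU x s : 0 <= s <= t -> rnorm (U s (Q x)) <= M * (cQ * rnorm x).
  by move=> st; apply: le_trans (HM _ _ st) _; rewrite ler_wpM2l.
have bF x s : 0 <= s <= t -> rnorm (F x s) <= K * A x.
  apply: HK => // {}s /andP[s0 st]; rewrite Feq // subrK.
  by apply: le_trans (memory_functional_bound _) _; rewrite ler_wpM2l // bU // s0.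
have bC x : rnorm (conv0t (F x) v t) <= t * (K * A x * (M * rnorm z)).
  apply: (conv_bound (@Fc x) (@Uc z) t0 (mulr_ge0 K0 (A0 x)) (mulr_ge0 M0 (rnorm_ge0 z))).
    exact: bF.
  by move=> s; exact: HM.
exists (cP + M * cQ + t * (K * (MB * (M * cQ)) * (M * rnorm z))) => x.
rewrite /G; apply: le_trans (rnormD _ _) _; rewrite rnormN.
have h1 := rnormD (P x) (U t (Q x)).
have h2 : rnorm (U t (Q x)) <= M * (cQ * rnorm x) by apply: bU; rewrite t0 lexx.
have := bP x; have := bC x; rewrite /A.
have -> : (cP + M * cQ + t * (K * (MB * (M * cQ)) * (M * rnorm z))) * rnorm x =
  cP * rnorm x + M * (cQ * rnorm x) +
  t * (K * (MB * (M * (cQ * rnorm x))) * (M * rnorm z)) by ring.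
by lra.
Qed.

Lemma dynamics_continuous x :
  continuous (fun t : R => P x + U t (Q x) - conv0t (F x) v (Num.max 0 t)).
Proof.
move=> t; apply: cvgB; last exact: (conv_continuous (@Fc x) (@Uc z)).
by apply: cvgD; [exact: cvg_cst|exact: Uc].
Qed.

Lemma dynamics0 x : G 0 x = x.
Proof.
by rewrite /G U0 /conv0t bochner0t_0 subr0 /Q /projQ -/(P x) addrC subrK.
Qed.

End ProjectedDynamics.

(** * Return from the extended functions to the half-line *)

Theorem theorem3 (R : realType) (H : completeNormedModType R[i])
    (ip : H -> H -> R[i]) (hip : is_inner_product ip)
    (U : R -> H -> H) (hU : C0_semigroup U)
    (z Ldz : H) (hz0 : z != 0) (hLdz : is_gen_adjoint ip U z Ldz)
    (f : H -> R -> Cplx R)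
    (hf_cont : forall x : H, {within `[0, +oo[, continuous (f x)})
    (hf_eq : forall (x : H) (t : R), 0 <= t ->
       f x t = ip (U t (projQ ip z x)) (projQ ip z Ldz) / ip z z
               - bochner0t (fun s : R =>
                   f x (t - s) * (ip (U s z) (projQ ip z Ldz) / ip z z)) t) :
  C0_semigroup (fun (t : R) (x : H) =>
    projP ip z x + U t (projQ ip z x)
    - bochner0t (fun s : R => f x (t - s) *: U s z) t).
Proof.
have [Ub U0 UD Uc] := hU.
(* Extending by the value at 0 makes every function continuous on all of R. *)
pose V (t : R) x := U (Num.max 0 t) x.
pose F x (t : R) : Cplx R := f x (Num.max 0 t).
have max0 (t : R) : 0 <= Num.max 0 t by rewrite le_max lexx.
have VE t x : 0 <= t -> V t x = U t x by move=> t0; rewrite /V max_r.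
have FE x t : 0 <= t -> F x t = f x t by move=> t0; rewrite /F max_r.
have Vlin t a x y : V t (a *: x + y) = a *: V t x + V t y.
  by have [lin _] := Ub _ (max0 t); exact: lin.
have Vbdd t : exists M : R, forall x, rnorm (V t x) <= M * rnorm x.
  have [_ [M HM]] := Ub _ (max0 t); exists (rnorm M) => x.
  (* [M] is complex, but its product with the norm of [x] dominates a norm, hence is real,
     nonnegative and equal to its own modulus; so [rnorm M] is a real bound. *)
  have h := le_trans (normr_ge0 _) (HM x).
  by have := HM x; rewrite -(ger0_norm h) normrM normr_id !normE -ofRM lecR.
have V0 x : V 0 x = x by rewrite VE.
have VD (s t : R) x : 0 <= s -> 0 <= t -> V (s + t) x = V s (V t x).
  by move=> s0 t0; rewrite !VE ?addr_ge0 // UD.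
have Vc x : continuous (fun t => V t x) := continuous_max0 (Uc x).
have Fc x : continuous (F x) := continuous_max0 (hf_cont x).
have convE x t : 0 <= t ->
    bochner0t (fun s => f x (t - s) *: U s z) t = conv0t (F x) (fun s => V s z) t.
  move=> t0; apply: eq_bochner0t => // s /andP[s0 st].
  by rewrite FE ?subr_ge0 // VE.
(* The scalar integral in the equation for [f] is the functional applied to the vector-valued
   integral. *)
have Feq x t : 0 <= t -> F x t = memory_functional ip z Ldz (V t (projQ ip z x)) -
    memory_functional ip z Ldz (conv0t (F x) (fun s => V s z) t).
  move=> t0; rewrite FE // hf_eq // VE //; congr (_ - _).
  rewrite -(conv_map (memory_functional_lin hip) (memory_functional_bound hip)
    (Fc x) (Vc z) t0).
  apply: eq_bochner0t => // s /andP[s0 st].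
  by rewrite FE ?subr_ge0 // VE.
have adj x v : diff_quot V x h @[h --> 0^'+] --> v -> ip v z = ip x Ldz.
  move=> hv.
  (* Only positive [h] count in this limit, and there [V] and [U] agree. *)
  have hv' : diff_quot U x h @[h --> 0^'+] --> v.
    apply/cvg_rnormP => e e0; have /cvg_rnormP/(_ e e0) := hv.
    apply: filterS2 (nbhs_right_gt 0) => h h0.
    by rewrite /diff_quot VE // ltW.
  have <- : sg_gen U x = v by apply: (@cvg_lim H (@norm_hausdorff _ H)).
  by apply: hLdz; exists v.
pose G (t : R) x := projP ip z x + V t (projQ ip z x) - conv0t (F x) (fun s => V s z) t.
have GE t x : 0 <= t -> projP ip z x + U t (projQ ip z x)
    - bochner0t (fun s : R => f x (t - s) *: U s z) t = G t x.
  by move=> t0; rewrite convE // -VE.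
split.
- move=> t t0; split=> [a x y|].
    by rewrite !GE //; exact: (dynamics_lin Vlin Vc hip Fc Feq).
  have [M HM] := dynamics_bounded Vlin Vbdd Vc hip Fc Feq t0.
  by exists (ofR M) => x; rewrite GE // !normE -ofRM lecR; exact: HM.
- by move=> x; rewrite GE //; exact: dynamics0.
- move=> s t x s0 t0; rewrite !GE ?addr_ge0 //.
  exact: (dynamicsD Vlin Vbdd V0 VD Vc hip hz0 adj Fc Feq).
- move=> x.
  have c := dynamics_continuous Vc (ip := ip) (z := z) Fc (x := x).
  (* Agreement on [0, +oo[ with a function continuous on [R] gives continuity within the
     half-line. *)
  apply: subspace_eq_continuous (continuous_subspaceT c) => t.
  rewrite inE /= in_itv /= andbT => t0.
  by transitivity (G t x); [rewrite /G /from_subspace max_r|exact/esym/GE].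
Qed.
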